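(* Let $p$ be an odd prime and let $a \ge 1$ be an integer. Suppose that $G$ is an Isaacs group of degree $p^a$, let $S$ be a Sylow $2$-subgroup of $G$, let $Z$ be the unique subgroup of order $2$ in $S$, and write $K = O_p(G)$. Then $G = K N_G(Z)$ and $N_G(Z) \cap K = C_K(Z) > 1$.
   Context: All groups are finite. For an integer $e > 1$, a group $G$ is an Isaacs group of degree $e$ if $|G| = e^4 - e^3$ and $d = e^2 - e$ is the degree of some irreducible complex character of $G$ (so that $|G| = d(d+e)$). It is known that if $G$ is an Isaacs group of degree $p^a$, then $G$ has a unique minimal normal subgroup $N$, and every nontrivial $p'$-subgroup of $G$ acts Frobeniusly (fixed-point-freely) on $N$ by conjugation; in particular, for $p$ odd, a Sylow $2$-subgroup of $G$ has a unique subgroup of order $2$. $O_p(G)$ is the largest normal $p$-subgroup of $G$; $N_G(Z)$ and $C_K(Z)$ denote normalizer and centralizer. *)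

(* Defs.v *)
From mathcomp Require Import all_boot all_order all_algebra.
From mathcomp Require Import all_fingroup all_solvable all_field all_character.

Set Implicit Arguments.
Unset Strict Implicit.
Unset Printing Implicit Defensive.

Import GroupScope GRing.Theory.

(* The irreducible characters ['chi_i] take values in [algC]; since character
   values are algebraic, these are the irreducible complex characters of [G]. *)
Definition isaacs_group (gT : finGroupType) (e : nat) (G : {group gT}) : Prop :=
  [/\ (1 < e)%N,
      #|G| = (e ^ 4 - e ^ 3)%N
    & exists i : Iirr G, ('chi[G]_i 1%g = (e ^ 2 - e)%N%:R)%R].

Definition unique_subgroup_of_order (gT : finGroupType) (n : nat)
    (Z S : {group gT}) : Prop :=
  [/\ Z \subset S,
      #|Z| = n
    & forall Y : {group gT}, Y \subset S -> #|Y| = n -> Y :=: Z].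

(* Main.v *)
Require Import Defs.
From mathcomp Require Import all_boot all_order all_algebra.
From mathcomp Require Import all_fingroup all_solvable all_field all_character.
From mathcomp Require Import ring.

Set Implicit Arguments.
Unset Strict Implicit.
Unset Printing Implicit Defensive.

Import GroupScope GRing.Theory.
Import Order.POrderTheory Num.Theory.

(** Write q = p^a, so |G| = q^3 (q - 1) and the given character has degree
   q (q - 1). A computation with this character shows that it takes the value
   -q on N minus 1 and vanishes off N for a normal subgroup N of order q, that
   N is elementwise inverted by the involution z of Z, and that the nontrivial
   elements of N form one class whose centralizers are Sylow p-subgroups.
   Hence K is the centralizer of N, [z, G] lies in K, and the Frattini
   argument gives G = K N_G(Z).

   If C_K(Z) = 1, then K is abelian, so |K| <= q^2 since a degree is at most the
   index of an abelian subgroup, and H = N_G(Z) is a complement to K with a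
   unique involution, transitive on the nontrivial elements of N, whose point
   stabilizers Q are Sylow p-subgroups of H of order at least q. This is ruled
   out by the bound |Q| |C_N(Q)| <= |N|.

   The bound is proved by induction on N. The inductive step compares
   stabilizers of different points, which needs a conjugacy functor controlling
   fusion of p-subgroups in groups with at most one involution. We use the
   Glauberman-Solomon functor, which applies because such groups are p-stable
   for odd p. *)

(** * The Glauberman-Solomon functor *)

(** Stability is used only for groups acting on their own p-subgroups, where the sole involution is
    central and so acts trivially; it is never applied to N, which z inverts. The obstacle to
    exclude is a pair of conjugate quadratic p-elements acting as transvections on a plane. Two such
    generate a group of even order, but once the sole involution acts trivially the Sylow 2-subgroup
    of the image is cyclic, which is impossible for a group of even order generated by elements of
    odd order.

    The bound concerns the Chermak-Delgado measure |X| |C_N(X)|. It is proved for every subgroup X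
    of a point stabilizer and carries the factor |C_X(N)|, because the induction passes to a block
    on which the stabilizer of the block need not act faithfully. The blocks are the fixed points of
    the subgroup that the functor picks in a stabilizer modulo the kernel: control of fusion is what
    makes them blocks. *)

Definition quad (gT : finGroupType) (A : {set gT}) (x : gT) :=
  [forall a in A, [~ a, x, x] == 1].

Definition good (gT : finGroupType) (S A : {set gT}) :=
  [forall x in S, quad A x ==> (x \in 'C(A))].

(* The subgroup [D^*(S)] of Glauberman and Solomon. *)
Definition gsW (gT : finGroupType) (S : {set gT}) : {set gT} :=
  <<\bigcup_(A : {group gT} | (A <| S) && good S A) A>>.

Canonical gsW_group (gT : finGroupType) (S : {set gT}) : {group gT} :=
  Eval hnf in [group of gsW S].

Section GSW.
Variable gT : finGroupType.
Implicit Types (S A B : {group gT}).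

Lemma quadP (A : {set gT}) x :
  reflect (forall a, a \in A -> [~ a, x, x] = 1) (quad A x).
Proof.
by apply: (iffP forall_inP) => H a /H => [/eqP | ->].
Qed.

Lemma quadS (A B : {set gT}) x : A \subset B -> quad B x -> quad A x.
Proof. by move=> /subsetP sAB /quadP qB; apply/quadP => a /sAB/qB. Qed.

Lemma quadJ (A : {set gT}) x g : quad (A :^ g) (x ^ g) = quad A x.
Proof.
apply/quadP/quadP => H a Aa.
  have := H (a ^ g); rewrite memJ_conjg -!conjRg => /(_ Aa)/eqP.
  by rewrite conjg_eq1 => /eqP.
case/imsetP: Aa => b Bb ->; by rewrite -!conjRg H ?conj1g.
Qed.

Lemma goodP (S A : {set gT}) :
  reflect (forall x, x \in S -> quad A x -> x \in 'C(A)) (good S A).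
Proof. by apply: (iffP forall_inP) => H x /H => [/implyP | ?]; [|apply/implyP]. Qed.

Lemma goodJ (S A : {set gT}) g : good (S :^ g) (A :^ g) = good S A.
Proof.
apply/goodP/goodP => H x Sx qx.
  have := H (x ^ g); rewrite memJ_conjg quadJ => /(_ Sx qx).
  by rewrite centJ memJ_conjg.
case/imsetP: Sx qx => y Sy ->; rewrite quadJ => qy.
by rewrite centJ memJ_conjg H.
Qed.

Lemma gsW_max S A : A <| S -> good S A -> A \subset gsW S.
Proof. by move=> nA gA; rewrite sub_gen // (bigcup_max A) ?nA. Qed.

Lemma gsW_sub S : gsW S \subset S.
Proof. by rewrite gen_subG; apply/bigcupsP => A /andP[/normal_sub]. Qed.

Lemma gsWJ S g : gsW (S :^ g) = gsW S :^ g.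
Proof.
suff sW (T : {group gT}) h : gsW T :^ h \subset gsW (T :^ h).
  apply/eqP; rewrite eqEsubset sW andbT.
  by rewrite -(conjsgKV g (gsW _)) conjSg (subset_trans (sW _ _)) ?conjsgK.
rewrite sub_conjg gen_subG; apply/bigcupsP => A /andP[nA gA].
by rewrite -sub_conjg (gsW_max (A := (A :^ h)%G)) ?normalJ ?goodJ.
Qed.

Lemma gsW_norm S : 'N(S) \subset 'N(gsW S).
Proof.
apply/subsetP => g nSg; rewrite inE -gsWJ.
by rewrite (normP nSg).
Qed.

Lemma gsW_normal S : gsW S <| S.
Proof. by rewrite /normal gsW_sub (subset_trans (normG S)) ?gsW_norm. Qed.

(** An element quadratic on the join is quadratic on each good [A], so it centralizes each of them.
    Hence [gsW S] is the largest good normal subgroup of [S]. *)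
Lemma gsW_good S : good S (gsW S).
Proof.
apply/goodP => x Sx qx; rewrite cent_gen; apply/centP => y /bigcupP[A].
case/andP=> nA gA Ay; have qA : quad A x.
  by apply: quadS qx; rewrite gsW_max.
by have /centP := goodP _ _ gA x Sx qA; apply.
Qed.

Lemma gsW_center S : 'Z(S) \subset gsW S.
Proof.
apply: (gsW_max (A := 'Z(S)%G)); first exact: center_normal.
by apply/goodP => x Sx _; rewrite (subsetP _ x Sx) // centsC subsetIr.
Qed.

Lemma gsW_neq1 (p : nat) S : p.-group S -> S :!=: 1 -> gsW S != 1.
Proof.
move=> pS; apply: contraNneq => W1; rewrite (trivg_center_pgroup pS) //.
by apply/trivgP; rewrite -W1 gsW_center.
Qed.

(** Induction along the upper central series: if ['Z_m(W)] is central in [W], an element of the next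
    term has its commutators with [W] in ['Z_m(W)], so it is quadratic on [W], and goodness makes it
    centralize [W]. *)
Lemma gsW_abelian (p : nat) S : p.-group S -> abelian (gsW S).
Proof.
move=> pS; set W := gsW S.
have /ucnP[n defW]: nilpotent W by apply: pgroup_nil (pgroupS (gsW_sub S) pS).
suff sZ m : 'Z_m(W) \subset 'C(W) by have:= sZ n; rewrite defW.
elim: m => [|m IHm]; first by rewrite ucn0 sub1G.
apply/subsetP => x Zx; have Wx : x \in W := subsetP (ucn_sub _ _) x Zx.
apply: (goodP _ _ (gsW_good S)); first exact: (subsetP (gsW_sub S)).
apply/quadP => a Wa; apply/eqP/commgP; apply: (centP (subsetP IHm _ _)) Wx.
by rewrite -invgR groupV (subsetP (ucn_comm _ _)) ?mem_commg.
Qed.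

End GSW.

(** * Two conjugate transvections *)

Lemma fpf_involution_even (T : finType) (A : {set T}) (s : T -> T) :
    (forall x, x \in A -> [/\ s x \in A, s (s x) = x & s x != x]) ->
  ~~ odd #|A|.
Proof.
have [n] := ubnP #|A|; elim: n A => // n IHn A leAn sA.
have [-> | [x Ax]] := set_0Vmem A; first by rewrite cards0.
have [Asx ssx nsx] := sA x Ax.
rewrite (cardsD1 x) Ax (cardsD1 (s x)) 2!inE nsx Asx /= negbK.
apply: IHn => [|y]; last first.
  rewrite !inE => /and3P[ysx yx Ay]; have [Asy ssy nsy] := sA y Ay.
  split=> //; rewrite Asy andbT; apply/andP; split.
    by apply: contraNneq yx => e; rewrite -ssy e ssx.
  by apply: contraNneq ysx => e; rewrite -ssy e.
rewrite ltnS in leAn; apply: leq_trans leAn; rewrite (cardsD1 x A) Ax ltnS.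
by rewrite [X in _ <= X](cardsD1 (s x)) leq_addl.
Qed.

(* In the right regular representation a generator of a cyclic Sylow 2-subgroup
   is a product of an odd number of cycles of even length. *)
Lemma cyclic_Sylow2_odd (gT : finGroupType) (G S : {group gT}) (A : {set gT}) :
    2.-Sylow(G) S -> cyclic S -> G :=: <<A>> ->
    {in A, forall x, odd #[x]} ->
  odd #|G|.
Proof.
move=> sylS /cyclicP[s defS] defG oddA.
pose f (g : subg_of G) := perm (mulIg g).
have fM : {morph f : g h / (g * h)%g >-> (g * h)%g}.
  by move=> g h; apply/permP=> u; rewrite permM !permE mulgA.
pose fm := Morphism (in2W fM : {in [set: subg_of G] &, _}).
have fX g n : f (g ^+ n) = f g ^+ n by apply: (morphX fm); rewrite inE.
have f1 : f 1 = 1 by apply: (morph1 fm).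
have odd_f g : odd #[g] -> odd_perm (f g) = false.
  have oddX n : odd_perm (f g ^+ n) = odd n && odd_perm (f g).
    elim: n => [|n IHn]; first by rewrite odd_perm1.
    by rewrite expgS odd_permM IHn /=; case: odd; case: odd_perm.
  move=> oddg; have := oddX #[g]; rewrite -fX expg_order f1 odd_perm1 oddg.
  by case: odd_perm.
have Gs : s \in G by rewrite -cycle_subG -defS (pHall_sub sylS).
have : odd_perm (f (subg G s)) = false.
  pose B := [set g in G | ~~ odd_perm (f (subg G g))].
  have gB : group_set B.
    apply/group_setP; split=> [|g h]; rewrite !inE ?group1.
      by rewrite morph1 f1 odd_perm1.
    move=> /andP[Gg /negPf eg] /andP[Gh /negPf eh].
    by rewrite groupM // morphM // fM odd_permM eg eh.
  suff : s \in Group gB by rewrite inE => /andP[_ /negPf].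
  apply: subsetP Gs; rewrite defG gen_subG; apply/subsetP=> x Ax.
  have Gx : x \in G by rewrite defG mem_gen.
  rewrite inE Gx odd_f //; apply: dvdn_odd (oddA x Ax).
  by rewrite order_dvdn -morphX // expg_order morph1.
(* The sign is the parity of [#|T|] plus the number of cycles. That number is the odd part of
   [#|G|], so an even permutation forces [#|G|] to be odd. *)
rewrite /odd_perm; set T := subg_of G.
have cT : #|T| = #|G| by rewrite -cardsT (card_isog (isog_subg G)).
have cp : #|[set: T]| = (#|porbits (f (subg G s))| * #[s])%N.
  apply: (card_uniform_partition (P := porbits (f (subg G s)))); last first.
    rewrite (_ : porbits _ = orbit 'P <[f (subg G s)]> @: setT); last first.
      by apply/setP=> X; apply/imsetP/imsetP; case=> x _ ->;
        exists x; rewrite ?inE // porbit.unlock.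
    apply: orbit_partition.
    by apply/actsP=> a _ x; rewrite !inE.
  move=> _ /imsetP[x _ ->]; rewrite porbit.unlock.
  have -> : <[f (subg G s)]> = f @: <[subg G s]>.
    by rewrite -(morphimEsub fm) ?subsetT // morphim_cycle ?inE.
  rewrite -imset_comp card_imset; last first.
    by move=> g h; rewrite /= /aperm !permE => /mulgI.
  exact: (order_injm (injm_subg G)).
have os : #[s] = (#|G|`_2)%N by rewrite orderE -defS (card_Hall sylS).
have op : odd #|porbits (f (subg G s))|.
  have : odd (#|G|`_2^')%N by rewrite odd_2'nat part_pnat.
  have /eqP := cp; rewrite cardsT cT os -{1}(partnC 2 (cardG_gt0 G)) mulnC.
  by rewrite eqn_pmul2r ?part_gt0 // => /eqP <-.
by rewrite op cT addbT => /negbFE.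
Qed.

Local Open Scope ring_scope.

Lemma mulmx2E (R : pzRingType) m n (A : 'M[R]_(m, 2)) (B : 'M_(2, n)) i j :
  (A *m B) i j = A i 0 * B 0 j + A i 1 * B 1 j.
Proof. by rewrite mxE !big_ord_recl big_ord0 addr0 (_ : lift _ _ = 1) //; apply: val_inj. Qed.

Lemma matrix2P (R : Type) (A B : 'M[R]_2) :
  A 0 0 = B 0 0 -> A 0 1 = B 0 1 -> A 1 0 = B 1 0 -> A 1 1 = B 1 1 -> A = B.
Proof.
move=> e00 e01 e10 e11; apply/matrixP.
have lift1 : lift ord0 0 = 1 :> 'I_2 by apply: val_inj.
have ordP (i : 'I_2) : i = 0 \/ i = 1.
  by case: i => [[|[|//]]] lti; [left | right]; apply: val_inj.
by move=> i j; case: (ordP i) => ->; case: (ordP j) => ->.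
Qed.

Lemma det_mx22 (R : comPzRingType) (A : 'M[R]_2) :
  \det A = A 0 0 * A 1 1 - A 0 1 * A 1 0.
Proof.
rewrite (expand_det_row _ 0) !big_ord_recl big_ord0 /cofactor !det_mx11 !mxE.
have -> : lift (lift ord0 ord0) 0 = 0 :> 'I_2 by apply: val_inj.
have -> : lift ord0 ord0 = 1 :> 'I_2 by apply: val_inj.
by rewrite /= expr0 expr1 mul1r addr0 mulN1r mulrN.
Qed.

(** Conjugation by [diag(1, -1)], written entrywise. *)
Definition twist2 (R : pzRingType) (A : 'M[R]_2) : 'M[R]_2 :=
  \matrix_(i, j) ((-1) ^+ (i + j) * A i j).

Lemma twist2M (R : comPzRingType) (A B : 'M[R]_2) :
  twist2 (A *m B) = twist2 A *m twist2 B.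
Proof. by apply: matrix2P; rewrite !(mulmx2E, mxE) /=; ring. Qed.

Definition mx2 (R : pzRingType) (a b c d : R) : 'M[R]_2 :=
  \matrix_(i, j) if i == 0 then (if j == 0 then a else b)
                 else (if j == 0 then c else d).

Section Transvections.

Variables (gT : finGroupType) (H : {group gT}) (L : fieldType).
Variables (rH : mx_representation L H 2) (x y g0 : gT) (l : L).
Hypotheses (Hx : x \in H) (Hy : y \in H) (defH : H :=: <<[set x; y]>>).
Hypotheses (rHx : rH x = mx2 1 1 0 1) (rHy : rH y = mx2 1 0 l 1).
Hypotheses (nz2 : 2%:R != 0 :> L) (nz_l : l != 0).
Hypotheses (Hg0 : g0 \in H) (defy : y = (x ^ g0)%g).

Lemma transvections_det g : g \in H -> \det (rH g) = 1.
Proof.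
have gD : group_set [set h in H | \det (rH h) == 1].
  apply/group_setP; split=> [|h k]; rewrite !inE; first by rewrite group1 repr_mx1 det1 eqxx.
  move=> /andP[Hh /eqP eh] /andP[Hk /eqP ek].
  by rewrite groupM // repr_mxM // det_mulmx eh ek mulr1 eqxx.
suff sHD : H \subset Group gD by move/(subsetP sHD); rewrite inE => /andP[_ /eqP].
rewrite {1}defH gen_subG; apply/subsetP=> h; rewrite !inE.
by case/orP=> /eqP ->; rewrite ?Hx ?Hy ?rHx ?rHy det_mx22 !mxE /=; apply/eqP; ring.
Qed.

Hypothesis ffulH : mx_faithful rH.

(* [diag(1, -1)] inverts both generators, so it induces an involution of [H];
   away from the matrices with a zero in the second row it is fixed-point free. *)
Lemma transvections_even : ~~ odd #|H|.
Proof.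
have ex_tw g : g \in H -> exists2 h, h \in H & rH h = twist2 (rH g).
  pose D := [set g in H | [exists h in H, rH h == twist2 (rH g)]].
  have gD : group_set D.
    apply/group_setP; split=> [|h k]; rewrite !inE.
      rewrite group1 /=; apply/existsP; exists 1%g; rewrite group1 repr_mx1.
      by apply/eqP/matrix2P; rewrite !mxE /=; ring.
    move=> /andP[Hh /exists_inP[h' Hh' /eqP eh]].
    move=> /andP[Hk /exists_inP[k' Hk' /eqP ek]].
    rewrite groupM //=; apply/exists_inP; exists (h' * k')%g; rewrite ?groupM //.
    by rewrite !repr_mxM // eh ek twist2M.
  suff sHD : H \subset Group gD.
    by move/(subsetP sHD); rewrite inE => /andP[_ /exists_inP[h Hh /eqP e]]; exists h.
  have inv h : h \in H -> twist2 (rH h) *m rH h = 1%:M -> h \in D.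
    move=> Hh e; rewrite inE Hh /=; apply/exists_inP; exists h^-1%g; rewrite ?groupV //.
    by rewrite -[X in _ == X](repr_mxK rH Hh) e mul1mx.
  rewrite {1}defH gen_subG; apply/subsetP=> h /set2P[] ->; apply: inv => //.
    by rewrite rHx; apply/matrix2P; rewrite !(mulmx2E, mxE) /=; ring.
  by rewrite rHy; apply/matrix2P; rewrite !(mulmx2E, mxE) /=; ring.
pose s g := odflt 1%g [pick h in H | rH h == twist2 (rH g)].
have sP g : g \in H -> s g \in H /\ rH (s g) = twist2 (rH g).
  rewrite /s => /ex_tw[h Hh e]; case: pickP => [k /andP[Hk /eqP]//|/(_ h)].
  by rewrite Hh e eqxx.
pose A := [set g in H | rH g 1 0 == 0]; pose B := [set g in H | rH g 1 1 == 0].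
pose C := [set g in H | (rH g 1 0 != 0) && (rH g 1 1 != 0)].
have evenC : ~~ odd #|C|.
  apply: (@fpf_involution_even _ C s) => g; rewrite !inE => /and3P[Hg c0 d0].
  have [Hs es] := sP g Hg; have [Hss ess] := sP _ Hs; split.
  - by rewrite Hs es !mxE /= !mulf_eq0 !signr_eq0 /= c0 d0.
  - apply: (mx_faithful_inj ffulH) => //; rewrite ess es.
    by apply: matrix2P; rewrite !mxE /=; ring.
  apply: contraNneq c0 => e; move/matrixP/(_ 1 0): es; rewrite e !mxE /= expr1 mulN1r.
  by move/eqP; rewrite -addr_eq0 -mulr2n -mulr_natl mulf_eq0 (negPf nz2).
(* The row [(0, 1)] spans the fixed line of [x] and [(1, 0)] that of [y], so [g0] sends the first
   line to the second. Membership in [A] or [B] says that the bottom row of [g] lies on one of these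
   lines; right multiplication by [g0] maps [A] into [B], and its inverse maps [B] into [A]. *)
have cAB : #|B| = #|A|.
  have g0x : rH x *m rH g0 = rH g0 *m rH y.
    by rewrite -!repr_mxM // defy conjgE !mulgA mulgV mul1g.
  have d0 : rH g0 1 1 = 0.
    have /matrixP/(_ 1 0) := g0x; rewrite rHx rHy !(mulmx2E, mxE) /=.
    rewrite mul0r add0r mul1r mulr1 -[LHS]addr0 => /addrI/esym/eqP.
    by rewrite mulf_eq0 (negPf nz_l) orbF => /eqP.
  have h0 : rH (g0^-1)%g 0 0 = 0.
    have : rH (g0^-1)%g *m rH x = rH y *m rH (g0^-1)%g.
      by rewrite -!repr_mxM ?groupV // defy conjgE -!mulgA mulgV mulg1.
    move/matrixP/(_ 0 1); rewrite rHx rHy !(mulmx2E, mxE) /=.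
    by rewrite !mulr1 mul1r mul0r addr0 -[RHS]add0r => /addIr.
  apply/eqP; rewrite eqn_leq; apply/andP; split.
    rewrite -(card_imset B (mulIg (g0^-1)%g)); apply/subset_leq_card/subsetP=> _ /imsetP[h + ->].
    rewrite !inE => /andP[Hh /eqP e]; rewrite groupM ?repr_mxM ?groupV //.
    by rewrite mulmx2E e h0 mul0r mulr0 addr0 eqxx.
  rewrite -(card_imset A (mulIg g0)); apply/subset_leq_card/subsetP=> _ /imsetP[h + ->].
  rewrite !inE => /andP[Hh /eqP e]; rewrite groupM ?repr_mxM //.
  by rewrite mulmx2E e d0 mul0r mulr0 addr0 eqxx.
have tiAB : A :&: B = set0.
  apply/setP=> g; rewrite !inE; apply/negP=> /andP[/andP[Hg /eqP c0] /andP[_ /eqP d0]].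
  have /matrixP/(_ 1 1) := repr_mxK rH Hg 1%:M.
  by rewrite mul1mx mulmx2E c0 d0 !mul0r addr0 mxE => /eqP; rewrite eq_sym oner_eq0.
have defH3 : H = (A :|: B) :|: C :> {set gT}.
  apply/setP=> g; rewrite !inE; case: (g \in H) => //=.
  by case: (rH g 1 0 == 0); case: (rH g 1 1 == 0).
have tiC : (A :|: B) :&: C = set0.
  apply/setP=> g; rewrite !inE; case: (g \in H) => //=.
  by case: (rH g 1 0 == 0); case: (rH g 1 1 == 0).
by rewrite defH3 cardsU tiC cardsU tiAB cards0 !subn0 cAB addnn oddD odd_double.
Qed.

End Transvections.

Definition uniq_inv (gT : finGroupType) (A : {set gT}) :=
  {in A &, forall t u, #[t]%g = 2%N -> #[u]%g = 2%N -> t = u}.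

(** Cayley-Hamilton with determinant 1 and square 1 says that the trace times [A] is the scalar 2,
    so the trace is nonzero and [A] is scalar. *)
Lemma SL2_involution (L : fieldType) (A : 'M[L]_2) :
  2%:R != 0 :> L -> \det A = 1 -> A *m A = 1%:M -> A = 1%:M \/ A = - 1%:M.
Proof.
move=> nz2 dA AA.
have detA : A 0 0 * A 1 1 - A 0 1 * A 1 0 = 1 by rewrite -det_mx22.
have e00 : A 0 0 * A 0 0 + A 0 1 * A 1 0 = 1 by rewrite -mulmx2E AA mxE.
have e01 : A 0 0 * A 0 1 + A 0 1 * A 1 1 = 0 by rewrite -mulmx2E AA mxE.
have e10 : A 1 0 * A 0 0 + A 1 1 * A 1 0 = 0 by rewrite -mulmx2E AA mxE.
have e11 : A 1 0 * A 0 1 + A 1 1 * A 1 1 = 1 by rewrite -mulmx2E AA mxE.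
have c0 : (A 0 0 + A 1 1) * A 1 0 = 0 by rewrite -e10; ring.
have b0 : (A 0 0 + A 1 1) * A 0 1 = 0 by rewrite -e01; ring.
have t2 : (A 0 0 + A 1 1) * A 0 0 = 2%:R by rewrite -[2]/(1 + 1) -{1}e00 -detA; ring.
have t2' : (A 0 0 + A 1 1) * A 1 1 = 2%:R by rewrite -[2]/(1 + 1) -{1}e11 -detA; ring.
have nzt : A 0 0 + A 1 1 != 0.
  by apply: contraNneq nz2 => e; rewrite -t2 e mul0r.
have {c0} c0 : A 1 0 = 0 by apply: (mulfI nzt); rewrite c0 mulr0.
have {b0} b0 : A 0 1 = 0 by apply: (mulfI nzt); rewrite b0 mulr0.
have ad : A 0 0 = A 1 1 by apply: (mulfI nzt); rewrite t2 t2'.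
have : (A 0 0) ^+ 2 == 1 ^+ 2 by rewrite expr1n -e00 b0 mul0r addr0 expr2.
rewrite eqf_sqr => /orP[] /eqP a1; [left | right].
  by apply: matrix2P; rewrite !mxE /= ?c0 ?b0 -?ad ?a1.
by apply: matrix2P; rewrite !mxE /= ?c0 ?b0 -?ad ?a1 ?oppr0.
Qed.

(* A Sylow 2-subgroup is cyclic or generalized quaternion, and its involution
   lies in the kernel, so its image is cyclic: in the quaternion case it is
   generated by involutions of SL_2. *)
Lemma no_transvections (gT : finGroupType) (J : {group gT}) (L : fieldType)
    (rJ : mx_representation L J 2) (x y g0 : gT) (l : L) :
    x \in J -> y \in J -> J :=: <<[set x; y]>> -> odd #[x]%g -> odd #[y]%g ->
    rJ x = mx2 1 1 0 1 -> rJ y = mx2 1 0 l 1 -> 2%:R != 0 :> L -> l != 0 ->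
    g0 \in J -> y = (x ^ g0)%g ->
  uniq_inv J -> ~ {in J, forall t, #[t]%g = 2%N -> t \in rker rJ}.
Proof.
move=> Jx Jy defJ ox oy rx ry nz2 nz_l Jg0 defy uJ kJ.
have detJ := transvections_det Jx Jy defJ rx ry.
pose K := rker_group rJ; have nKJ : J \subset 'N(K) := normal_norm (rker_normal rJ).
pose rH := kquo_repr rJ; have ffH : mx_faithful rH := kquo_mx_faithful rJ.
have rHE t : t \in J -> rH (coset K t) = rJ t.
  by move=> Jt; rewrite /rH /kquo_repr quo_repr_coset.
have defH : (J / K)%g = <<[set coset K x; coset K y]>>%g.
  rewrite [in LHS]defJ quotient_gen ?quotientE.
    by rewrite /quotient morphimU !morphim_set1 ?(subsetP nKJ).
  by apply/subsetP=> u /set2P[] ->; rewrite ?(subsetP nKJ).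
have oddH g : g \in J -> odd #[g]%g -> odd #[coset K g]%g.
  by move=> Jg; apply: dvdn_odd; apply: morph_order; rewrite (subsetP nKJ).
have := @transvections_even _ (J / K)%G _ rH (coset K x) (coset K y) (coset K g0) l.
rewrite !mem_quotient // !rHE // => /(_ isT isT defH rx ry nz2 nz_l isT).
rewrite defy morphJ ?(subsetP nKJ) // => /(_ erefl ffH)/negP; apply.
have [S sylS] := Sylow_exists 2 J; have [sSJ pS _] := and3P sylS.
have sylSK : 2.-Sylow(J / K)%g (S / K)%g by apply: quotient_pHall => //; apply: subset_trans nKJ.
apply: (cyclic_Sylow2_odd sylSK _ defH) => [|u /set2P[] ->]; try exact: oddH.
have [-> | ntS] := eqVneq S 1%G; first by rewrite /= quotient1 cyclic1.
have [_ dv2 _] := pgroup_pdiv pS ntS.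
have [z Sz oz] := Cauchy (isT : prime 2) dv2.
have o1 : #|'Ohm_1(S)|%g = 2.
  rewrite Ohm1Eprime (_ : [set _ in _ | _] = [set z]) //.
  apply/setP=> t; rewrite !inE; apply/andP/eqP => [[St pr_t]|->]; last by rewrite oz.
  have := mem_p_elt pS St; rewrite /p_elt pnatE // inE => /eqP ot.
  by apply: uJ; rewrite ?(subsetP sSJ).
have /(prime_Ohm1P pS ntS)/orP[/(quotient_cyclic K) // | /=] := o1.
move/eqP/quaternion_classP=> [n n_gt2 isoS].
have [[u v] extS _] := generators_quaternion n_gt2 isoS.
have [_ _ [_ _ _ [_ Om2] _] _ _] := quaternion_structure n_gt2 extS isoS.
pose D := [set t in S | (rJ t == 1%:M) || (rJ t == - 1%:M)].
have gD : group_set D.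
  apply/group_setP; split=> [|h k]; rewrite !inE; first by rewrite group1 repr_mx1 eqxx.
  move=> /andP[Sh eh] /andP[Sk ek].
  rewrite groupM // repr_mxM ?(subsetP sSJ) //.
  by case/orP: eh => /eqP ->; case/orP: ek => /eqP ->;
    rewrite ?mulmxN ?mulNmx ?mulmx1 ?opprK ?eqxx ?orbT.
have /subsetP sSD : S \subset Group gD.
  (* A generalized quaternion group is generated by its elements of order dividing 4, whose squares
     are trivial or the involution. *)
  rewrite -{1}Om2 (OhmE _ pS) gen_subG; apply/subsetP=> t; rewrite !inE => /andP[St /eqP t4].
  rewrite St; have Jt := subsetP sSJ t St.
  have kt : rJ (t ^+ 2)%g = 1%:M.
    have [-> | nt2] := eqVneq (t ^+ 2)%g 1%g; first exact: repr_mx1.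
    have /kJ : #[t ^+ 2]%g = 2%N.
      by apply: nt_prime_order; rewrite // -expgM.
    by rewrite groupX // => /(_ isT); rewrite inE mul1mx => /andP[_ /eqP].
  rewrite expgS expg1 repr_mxM // in kt.
  by case: (SL2_involution nz2 (detJ t Jt) kt) => ->; rewrite eqxx ?orbT.
have [SK1 | ntSK] := eqVneq (S / K)%g 1%g; first by rewrite /= SK1 cyclic1.
have /trivgPn[w SKw ntw] := ntSK.
apply/cyclicP; exists w; apply/eqP; rewrite eqEsubset cycle_subG SKw andbT.
have SKE u' : u' \in (S / K)%g -> u' != 1%g -> rH u' = - 1%:M.
  case/morphimP=> t Nt St -> ; have /sSD := St; rewrite inE => /andP[_].
  rewrite /= rHE ?(subsetP sSJ) // => /orP[] /eqP e //; rewrite coset_id ?eqxx //.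
  by rewrite inE (subsetP sSJ) // e mul1mx eqxx.
apply/subsetP=> t SKt; have [-> | ntt] := eqVneq t 1%g; first exact: group1.
suff -> : t = w by exact: cycle_id.
have sSKJ : (S / K \subset J / K)%g by apply: quotientS.
by apply: (mx_faithful_inj ffH); rewrite ?(subsetP sSKJ) // !SKE.
Qed.

(** * Pairs of conjugate quadratic unipotent matrices *)

Lemma subr1_expp (R : nzRingType) (p e : nat) (x : R) :
  p \in [pchar R] -> (x - 1) ^+ (p ^ e) = x ^+ (p ^ e) - 1.
Proof.
move=> pR; elim: e => [|e IHe]; first by rewrite !expr1.
rewrite expnSr !exprM IHe -(pFrobenius_autE pR) pFrobenius_autB_comm ?pFrobenius_aut1 //.
exact: commr1.
Qed.

(** With all eigenvalues zero the characteristic polynomial would be ['X ^+ n.+1], and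
    Cayley-Hamilton would make this power of [C] vanish. *)
Lemma closed_not_nilpotent_eigenvalue (L : closedFieldType) n (C : 'M[L]_n.+1) :
  C ^+ n.+1 != 0 -> exists2 r, r != 0 & eigenvalue C r.
Proof.
move=> nzC; have [rs defc] := closed_field_poly_normal (char_poly C).
rewrite (monicP (char_poly_monic C)) scale1r in defc.
have [/hasP[r rs_r nz_r] | /hasPn rs0] := boolP (has (fun r => r != 0) rs).
  exists r => //; rewrite eigenvalue_root_char defc root_prod_XsubC //.
case/negP: nzC; rewrite -(Cayley_Hamilton C) defc.
have -> : \prod_(z <- rs) ('X - z%:P) = 'X ^+ n.+1 :> {poly L}.
  rewrite big_seq (eq_bigr (fun=> 'X)) => [|z /rs0/negPn/eqP ->]; last by rewrite subr0.
  rewrite -big_seq big_const_seq count_predT iter_mulr_1.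
  have := size_char_poly C; rewrite defc size_prod_XsubC => -[->//].
by rewrite rmorphXn /= horner_mx_X.
Qed.

Section TwoUnipotents.

Variables (p : nat) (gT : finGroupType) (J : {group gT}) (n : nat).
Variables (rG : mx_representation 'F_p J n.+1) (x y g0 : gT).
Hypotheses (p_pr : prime p) (p_odd : odd p).
Hypotheses (Jx : x \in J) (Jy : y \in J) (defJ : J :=: <<[set x; y]>>%g).
Hypotheses (Jg0 : g0 \in J) (defy : y = (x ^ g0)%g).
Hypotheses (uJ : uniq_inv J) (kJ : {in J, forall t, #[t]%g = 2%N -> t \in rker rG}).
Hypotheses (ox : odd #[x]%g) (oy : odd #[y]%g).
Let A := rG x - 1.
Let B := rG y - 1.
Hypotheses (AA : A * A = 0) (BB : B * B = 0).

(* Otherwise an eigenvector [v] of [A * B] over the algebraic closure spans with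
   [v *m A] a plane on which [x] and [y] act as transvections. *)
Lemma two_unipotents_nilpotent : (A * B) ^+ n.+1 = 0.
Proof.
have [L [f _]] := countable_algebraic_closure 'F_p.
apply/eqP/negPn/negP => nzAB.
have inj0 (X : 'M['F_p]_n.+1) : (map_mx f X == 0) = (X == 0).
  by rewrite -(map_mx0 f) (inj_eq map_mx_inj).
have [r nzr /eigenvalueP[v vAB nzv]] : exists2 r, r != 0 & eigenvalue (map_mx f (A * B)) r.
  by apply: closed_not_nilpotent_eigenvalue; rewrite -rmorphXn inj0.
pose rL := map_repr f rG; pose A' := map_mx f A; pose B' := map_mx f B.
rewrite map_mxM -/A' -/B' mulmxA in vAB.
have AA' : A' *m A' = 0 by rewrite -map_mxM [A *m A]AA map_mx0.
have BB' : B' *m B' = 0 by rewrite -map_mxM [B *m B]BB map_mx0.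
have rLx : rL x = 1%:M + A' by rewrite /A' map_mxB map_mx1 addrC subrK.
have rLy : rL y = 1%:M + B' by rewrite /B' map_mxB map_mx1 addrC subrK.
pose w := v *m A'.
have wA : w *m A' = 0 by rewrite -mulmxA AA' mulmx0.
have wB : w *m B' = r *: v by [].
have vB : v *m B' = 0.
  by apply: (scalerI nzr); rewrite scaler0 scalemxAl -wB -mulmxA BB' mulmx0.
pose V : 'M_(2, n.+1) := \matrix_(i < 2) if i == 0 then v else w.
have rowV (u : 'rV_2) : u *m V = u 0 0 *: v + u 0 1 *: w.
  rewrite mulmx_sum_row !big_ord_recl big_ord0 addr0 !rowK /=.
  by congr (_ + u _ _ *: _); apply: val_inj.
have row2 (X Y : 'M[L]_(2, n.+1)) : row 0 X = row 0 Y -> row 1 X = row 1 Y -> X = Y.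
  move=> e0 e1; apply/row_matrixP => -[[|[|//]] lti].
    by rewrite (_ : Ordinal _ = 0) //; apply: val_inj.
  by rewrite (_ : Ordinal _ = 1) //; apply: val_inj.
have Vx : V *m rL x = mx2 1 1 0 1 *m V.
  rewrite rLx mulmxDr mulmx1.
  by apply: row2; rewrite linearD /= !row_mul rowV !rowK !mxE /=
     ?wA ?scale1r ?scale0r ?addr0 ?add0r.
have Vy : V *m rL y = mx2 1 0 r 1 *m V.
  rewrite rLy mulmxDr mulmx1.
  by apply: row2; rewrite linearD /= !row_mul rowV !rowK !mxE /=
     ?vB ?wB ?scale1r ?scale0r ?addr0 ?add0r // addrC.
have freeV : row_free V.
  rewrite -kermx_eq0; apply/rowV0P => u /sub_kermxP; rewrite rowV => uV.
  have /eqP : (u 0 0 *: v + u 0 1 *: w) *m B' = 0 by rewrite uV mul0mx.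
  rewrite mulmxDl -!scalemxAl vB scaler0 add0r wB !scalemx_eq0 (negPf nzr) (negPf nzv) !orbF => /eqP u1.
  move/eqP: uV; rewrite u1 scale0r addr0 scalemx_eq0 (negPf nzv) orbF => /eqP u0.
  apply/rowP => -[[|[|//]] lti]; rewrite mxE.
    by rewrite -[RHS]u0; congr (u _ _); apply: val_inj.
  by rewrite -[RHS]u1; congr (u _ _); apply: val_inj.
pose D := [set g in J | (V *m rL g <= V)%MS].
have gD : group_set D.
  apply/group_setP; split=> [|g h]; rewrite !inE; first by rewrite group1 repr_mx1 mulmx1 submx_refl.
  move=> /andP[Jg sg] /andP[Jh sh]; rewrite groupM // repr_mxM // mulmxA.
  exact: submx_trans (submxMr _ sg) sh.
have sJD g : g \in J -> (V *m rL g <= V)%MS.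
  suff sJD : J \subset Group gD by move/(subsetP sJD); rewrite inE => /andP[].
  rewrite {1}defJ gen_subG; apply/subsetP=> h; rewrite !inE.
  by case/orP=> /eqP ->; rewrite ?Jx ?Jy ?Vx ?Vy submxMl.
(* The matrix of [g] on the plane in the basis [v], [w]. As [V] has independent rows, identities for
   [M] can be checked after multiplication by [V]. *)
pose M g := V *m rL g *m pinvmx V.
have MV g : g \in J -> M g *m V = V *m rL g by move=> Jg; apply: mulmxKpV; apply: sJD.
have Minj := @row_free_inj _ 2 2 _ _ freeV.
have Mrepr : mx_repr J M.
  split=> [|g h Jg Jh]; apply: Minj => /=; first by rewrite MV // repr_mx1 mulmx1 mul1mx.
  by rewrite MV ?groupM // -[RHS]mulmxA (MV h) // repr_mxM // [RHS]mulmxA (MV g) // mulmxA.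
pose rM := MxRepresentation Mrepr.
have rMx : rM x = mx2 1 1 0 1 by apply: Minj; rewrite /= MV.
have rMy : rM y = mx2 1 0 r 1 by apply: Minj; rewrite /= MV.
have nz2 : 2%:R != 0 :> L.
  rewrite -(rmorph_nat f) fmorph_eq0 -(dvdn_pcharf (pchar_Fp p_pr)).
  by rewrite gtnNdvd // odd_prime_gt2.
apply: (no_transvections Jx Jy defJ ox oy rMx rMy nz2 nzr Jg0 defy uJ).
move=> t Jt /(kJ Jt); rewrite !inE Jt !mul1mx /= => /eqP rt1.
by apply/eqP; apply: Minj; rewrite MV // map_reprE rt1 map_mx1 mulmx1 mul1mx.
Qed.

(* Nonzero words in [A] and [B] alternate, so the spans [U k] of the words of
   length [k] descend to 0, and [J] acts trivially on each [U k / U k.+1]. *)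
Lemma two_unipotents_p'elt t : t \in J -> p^'.-elt t -> t \in rker rG.
Proof.
move=> Jt p't; have AB0 := two_unipotents_nilpotent.
pose X (b : bool) := if b then A else B.
pose w := fix w b k := if k is k'.+1 then w (~~ b) k' * X b else 1.
have wS b k : w b k.+1 = w (~~ b) k * X b by [].
have XX b : X b * X b = 0 by case: b.
have wX b k : w b k.+1 * X b = 0 by rewrite wS -mulrA XX mulr0.
have wQ b k : exists Q, w b k.+1 = Q * w b k.
  elim: k b => [|k IHk] b; first by exists (X b); rewrite wS mulr1 mul1r.
  by have [Q e] := IHk (~~ b); exists Q; rewrite wS e -mulrA.
pose U k := (w true k + w false k)%MS.
have wU b k : (w b k <= U k)%MS by case: b; rewrite ?addsmxSl ?addsmxSr.
have sub_U k m (C : 'M_(m, _)) : (w true k <= C)%MS -> (w false k <= C)%MS -> (U k <= C)%MS.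
  by move=> s1 s2; rewrite addsmx_sub s1.
have US k : (U k.+1 <= U k)%MS.
  apply: sub_U; [have [Q ->] := wQ true k | have [Q ->] := wQ false k];
    exact: submx_trans (submxMl _ _) (wU _ _).
have UX b k : (U k *m X b <= U k.+1)%MS.
  rewrite addsmxMr addsmx_sub.
  have wb c : (w c k *m X b <= U k.+1)%MS.
    have [-> | nbc] := eqVneq c (~~ b); first exact: (wU b k.+1).
    have -> : c = b by move: nbc; clear; case: c; case: b.
    case: k => [|k]; last by rewrite [_ *m _]wX sub0mx.
    by rewrite mul1mx; have := wU b 1; rewrite wS /= mul1r.
  by rewrite !wb.
(* The alternating word of length [2(n+1)] ending in [B] is [(A * B) ^+ n.+1 = 0]; with two more
   letters both alternating words contain it as a factor. *)
pose K := (n.+1).*2.+2.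
have UK : (U K <= (0 : 'M['F_p]_n.+1))%MS.
  have w0 m : w false m.*2 = (A * B) ^+ m.
    elim: m => [|m IHm] //; rewrite doubleS wS wS IHm exprSr mulrA //.
  have w1 : w false n.+1.*2 = 0 by rewrite w0 AB0.
  have [Q w2] := wQ false n.+1.*2.
  apply: sub_U; first by rewrite wS w2 w1 mulr0 mul0r sub0mx.
  by rewrite wS wS w1 !mul0r sub0mx.
pose D := [set g in J | [forall k : 'I_K, (U k *m (rG g - 1) <= U k.+1)%MS]].
have gD : group_set D.
  apply/group_setP; split=> [|g h]; rewrite !inE.
    by rewrite group1; apply/forallP=> k; rewrite repr_mx1 subrr mulmx0 sub0mx.
  move=> /andP[Jg /forallP sg] /andP[Jh /forallP sh]; rewrite groupM //=.
  apply/forallP=> k; rewrite repr_mxM //.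
  have -> : rG g *m rG h - 1 = (rG g - 1) *m (rG h - 1) + (rG g - 1) + (rG h - 1).
    by rewrite mulmxBr mulmxBl mulmx1 mul1mx subrK addrA subrK.
  move: (sg k) (sh k); move: (rG g - 1) (rG h - 1) => C E sC sE.
  rewrite !mulmxDr addmx_sub // addmx_sub // mulmxA.
  by apply: submx_trans (submxMr _ (submx_trans sC (US k))) sE.
have nilJ g : g \in J -> (rG g - 1) ^+ (p ^ K) = 0.
  have leK : (K <= p ^ K)%N by rewrite ltnW // ltn_expl // prime_gt1.
  move=> Jg; rewrite -(subnKC leK) exprD (_ : _ ^+ K = 0) ?mul0r //.
  suff sgU k : (k <= K)%N -> ((rG g - 1) ^+ k <= U k)%MS.
    by apply/eqP; rewrite -submx0 (submx_trans (sgU K _)).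
  have sJD : J \subset Group gD.
    rewrite {1}defJ gen_subG; apply/subsetP=> h hxy; rewrite inE.
    have -> : h \in J by case/set2P: hxy => ->.
    by apply/forallP=> k'; case/set2P: hxy => ->; [apply: (UX true) | apply: (UX false)].
  have := subsetP sJD g Jg; rewrite inE Jg /= => /forallP sg.
  elim: k => [_|k IHk ltkK]; first exact: (wU true 0).
  rewrite exprSr; apply: submx_trans (submxMr _ (IHk (ltnW ltkK))) _.
  exact: (sg (Ordinal ltkK)).
(* In characteristic [p], nilpotency of [rG t - 1] makes [t ^+ (p ^ K)] act trivially, and for a
   [p']-element this power generates [<[t]>]. *)
have pM : p \in [pchar 'M['F_p]_n.+1] by rewrite pchar_lalg pchar_Fp.
have rtp : rG (t ^+ (p ^ K))%g = 1.
  by rewrite repr_mxX //; apply/eqP; rewrite -subr_eq0 -subr1_expp // nilJ.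
have : (t ^+ (p ^ K))%g \in rker rG by rewrite inE groupX // mul1mx rtp eqxx.
have /eqP gen_t : generator <[t]>%g (t ^+ (p ^ K))%g.
  by rewrite generator_coprime coprime_sym coprimeXl // prime_coprime // -p'natE.
by rewrite -!cycle_subG -gen_t.
Qed.

End TwoUnipotents.

Local Close Scope ring_scope.

(** * Stability *)

Lemma quad_morphim (aT rT : finGroupType) (D A : {group aT}) (f : {morphism D >-> rT}) x :
  A \subset D -> x \in D -> quad A x -> quad (f @* A) (f x).
Proof.
move=> /subsetP sAD Dx /quadP qA; apply/quadP=> _ /morphimP[a Da Aa ->].
by rewrite -!morphR ?groupR ?qA ?morph1.
Qed.

(** In additive notation [[~ e, x]] is [e] times [rx - 1]. *)
Lemma quad_abelem_repr (p : nat) (gT : finGroupType) (E G : {group gT})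
    (abelE : p.-abelem E) (ntE : E :!=: 1) (nEG : G \subset 'N(E)) x :
  x \in G -> quad E x ->
  ((abelem_repr abelE ntE nEG x - 1) * (abelem_repr abelE ntE nEG x - 1) = 0)%R.
Proof.
move=> Gx /quadP qE; set rx := abelem_repr _ _ _ x.
have step e : e \in E ->
    (abelem_rV abelE ntE e *m (rx - 1) = abelem_rV abelE ntE [~ e, x])%R.
  move=> Ee; have Nx := subsetP nEG x Gx.
  rewrite commgEl abelem_rV_M ?groupV ?memJ_norm // abelem_rV_V // (abelem_rV_J _ _ nEG) //.
  by rewrite mulmxBr mulmx1 GRing.addrC.
apply/row_matrixP=> i; rewrite row0 rowE mulmxA.
rewrite -[delta_mx _ _](rVabelemK abelE ntE) step ?mem_rVabelem //.
have Ev := mem_rVabelem abelE ntE (delta_mx 0%R i).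
rewrite step ?qE ?abelem_rV_1 //.
by rewrite groupM ?groupV // memJ_norm ?(subsetP nEG).
Qed.

(** Fixed points of a coprime action lift through ['Phi(E)], so ['C_E(A)] covers [E / 'Phi(E)]; the
    Frattini subgroup consists of nongenerators, so ['C_E(A) = E]. *)
Lemma coprime_cent_Phi (p : nat) (gT : finGroupType) (E A : {group gT}) :
    p.-group E -> p^'.-group A -> A \subset 'N(E) ->
    A / 'Phi(E) \subset 'C(E / 'Phi(E)) ->
  A \subset 'C(E).
Proof.
move=> pE p'A nEA; rewrite centsC => cEA.
have nPhiA : A \subset 'N('Phi(E)) := gFnorm_trans _ nEA.
have sPhi := Phi_sub E.
have coEA : coprime #|E| #|A| := pnat_coprime pE p'A.
have := coprime_quotient_cent sPhi nPhiA coEA (pgroup_sol pE).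
rewrite (setIidPl cEA) => defE.
have sE : E \subset 'Phi(E) * 'C_E(A).
  rewrite -quotientSK ?gFnorm //= defE.
  by rewrite subxx.
have genE : 'Phi(E) <*> 'C_E(A) = E.
  apply/eqP; rewrite eqEsubset join_subG sPhi subsetIl /=.
  by rewrite (subset_trans sE) // -genM_join subset_gen.
by rewrite centsC -{1}(Phi_nongen genE) gen_subG subsetIr.
Qed.

Lemma pgroup_p'elt (p : nat) (gT : finGroupType) (G H : {group gT}) :
    G \subset 'N(H) -> (forall t, t \in G -> p^'.-elt t -> t \in H) ->
  p.-group (G / H).
Proof.
move=> nHG sH; apply/pgroupP=> q q_pr /(Cauchy q_pr)[u /morphimP[t Nt Gt ->] ou].
rewrite /= in ou; apply: contraTT (prime_gt1 q_pr) => p'q; rewrite -ou.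
have p'u : p^'.-elt (coset H t) by rewrite /p_elt ou pnatE.
rewrite -(constt_p_elt p'u) -morph_constt //= coset_id ?order1 //.
by rewrite sH ?groupX ?p_elt_constt.
Qed.

Section PStability.

Variables (p : nat) (gT : finGroupType) (E : {group gT}).
Hypotheses (p_pr : prime p) (p_odd : odd p) (pE : p.-group E).

(** The [p']-elements of [J] act trivially on the ['F_p]-module [E / 'Phi(E)] by
    [two_unipotents_p'elt], hence on [E] by coprime action. *)
Lemma two_quad_pgroup (J : {group gT}) x y g0 :
    J \subset 'N(E) -> uniq_inv J -> {in J, forall t, #[t] = 2 -> t \in 'C(E)} ->
    x \in J -> g0 \in J -> y = x ^ g0 -> J :=: <<[set x; y]>> ->
    p.-elt x -> quad E x ->
  p.-group (J / 'C(E)).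
Proof.
move=> nEJ uJ kJ Jx Jg0 defy defJ p_x qx.
apply: pgroup_p'elt => [|t Jt p't]; first exact: subset_trans nEJ (cent_norm E).
have [E1 | ntE] := eqVneq E 1%G; first by rewrite E1 /= cent1T inE.
have Jy : y \in J by rewrite defy groupJ.
have qy : quad E y by rewrite defy -(normP (subsetP nEJ g0 Jg0)) quadJ.
have odd_p z : p.-elt z -> odd #[z].
  by move=> pz; apply: odd_pgroup_odd p_odd pz.
set F := 'Phi(E)%G.
have nFE : E \subset 'N(F) := gFnorm _ _.
have nFJ : J \subset 'N(F) := gFnorm_trans _ nEJ.
have abV : p.-abelem (E / F) := Phi_quotient_abelem pE.
have ntV : E / F != 1.
  by rewrite -subG1 quotient_sub1 // proper_subn // Phi_proper.
have nVJ : J / F \subset 'N(E / F) by rewrite quotient_norms.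
pose rV := abelem_repr abV ntV nVJ.
pose rG := morphim_repr (rV : mx_representation _ (coset F @* J) _) nFJ.
have rGE z : rG z = rV (coset F z) by [].
have quadF z : z \in J -> quad E z -> ((rG z - 1) * (rG z - 1) = 0)%R.
  move=> Jz qz; rewrite rGE quad_abelem_repr ?mem_quotient //.
  exact: (@quad_morphim _ _ _ _ (coset_morphism F)) nFE (subsetP nFJ z Jz) qz.
have rkerE z : z \in J -> (z \in rker rG) = (coset F z \in 'C(E / F)).
  move=> Jz; rewrite rker_morphim rker_abelem inE Jz /= inE (subsetP nFJ) //=.
    by rewrite 2!inE mem_morphim ?(subsetP nFJ).
have ck z : z \in J -> z \in 'C(E) -> z \in rker rG.
  move=> Jz cz; rewrite rkerE // (subsetP (quotient_cent _ _)) //.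
  by rewrite mem_quotient.
have rkt : t \in rker rG.
  apply: (two_unipotents_p'elt p_pr p_odd Jx Jy defJ Jg0 defy uJ) => //.
  - by move=> z Jz oz; apply: ck => //; apply: kJ.
  - exact: odd_p.
  - by rewrite odd_p // defy p_eltJ.
  - exact: quadF.
  - exact: quadF.
rewrite rkerE // in rkt.
rewrite -cycle_subG; apply: (coprime_cent_Phi pE) => //.
  by rewrite cycle_subG (subsetP nEJ).
by rewrite quotient_cycle ?(subsetP nFJ) // cycle_subG.
Qed.

(** By the Baer-Suzuki theorem it suffices that [x] and each conjugate [x ^ g] generate a [p]-group
    modulo ['C(E)]. If they generate less than [G], induction puts both into the [p]-core of the
    image of what they generate; otherwise [two_quad_pgroup] applies. [H] is kept apart from [G]
    because the induction passes to subgroups that need not contain [E]. *)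
Lemma quad_pcore (H G : {group gT}) x :
    uniq_inv H -> G \subset H -> E \subset H -> G \subset 'N(E) ->
    x \in G -> p.-elt x -> quad E x ->
  coset 'C(E) x \in 'O_p(G / 'C(E)).
Proof.
move=> uH sGH sEH; have [n] := ubnP #|G|; elim: n G x sGH => // n IHn G x sGH leGn nEG Gx p_x qx.
have nCG : G \subset 'N('C(E)) := subset_trans nEG (cent_norm E).
apply: Baer_Suzuki; first exact: mem_quotient.
move=> _ /morphimP[g Ng Gg ->]; rewrite -morphJ ?(subsetP nCG) //.
set J := <<[set x; x ^ g]>>%G.
have sJG : J \subset G.
  by rewrite gen_subG; apply/subsetP=> z /set2P[] ->; rewrite ?groupJ.
have Jx : x \in J by rewrite mem_gen // set21.
have Jy : x ^ g \in J by rewrite mem_gen // set22.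
have defJ : <<[set coset 'C(E) x; coset 'C(E) (x ^ g)]>> = J / 'C(E).
  rewrite quotient_gen ?(subset_trans (subset_gen _) (subset_trans sJG nCG)) //.
  by rewrite /quotient morphimU !morphim_set1 ?(subsetP nCG) ?groupJ.
rewrite defJ.
have sub_uJ (A : {group gT}) : A \subset H -> uniq_inv A.
  by move=> /subsetP sAH t u At Au; apply: uH; apply: sAH.
have [eqJG | neqJG] := eqVneq J G.
  apply: (@two_quad_pgroup J x (x ^ g) g) => //; rewrite ?eqJG //; first exact: sub_uJ.
  (* [t ^ e] is again an involution of [H], hence equal to [t]. *)
  move=> t Gt ot; apply/centP=> e Ee; apply/commgP/conjg_fixP.
  have [Ht He] := (subsetP sGH t Gt, subsetP sEH e Ee).
  by apply: uH; rewrite ?orderJ ?groupJ.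
have ltJn : #|J| < n.
  by rewrite (leq_trans _ (ltnSE leGn)) // proper_card // properEneq neqJG.
have pO z : z \in J -> p.-elt z -> quad E z -> coset 'C(E) z \in 'O_p(J / 'C(E)).
  by move=> Jz pz qz; apply: IHn; rewrite ?(subset_trans sJG).
suff -> : J / 'C(E) = 'O_p(J / 'C(E)) by apply: pcore_pgroup.
apply/eqP; rewrite eqEsubset pcore_sub andbT -{1}defJ gen_subG.
apply/subsetP=> _ /set2P[] ->; apply: pO => //; rewrite ?p_eltJ //.
by rewrite -(normP (subsetP nEG g Gg)) quadJ.
Qed.

End PStability.

(** * Control of fusion *)

Lemma uniq_invS (gT : finGroupType) (A B : {set gT}) :
  A \subset B -> uniq_inv B -> uniq_inv A.
Proof. by move=> /subsetP sAB uB t u At Au; apply: uB; apply: sAB. Qed.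

(** As [#|B|] is odd, the 2-part of any preimage of an involution is itself an involution. *)
Lemma uniq_inv_quotient (gT : finGroupType) (G B : {group gT}) :
  B <| G -> odd #|B| -> uniq_inv G -> uniq_inv (G / B).
Proof.
move=> /andP[_ nBG] oddB uG.
have lift t : t \in G / B -> #[t] = 2 ->
    exists u, [/\ u \in G, #[u] = 2 & coset B u = t].
  case/morphimP=> u Nu Gu -> /= ot; exists u.`_2.
  have e2 : coset B u.`_2 = coset B u.
    by rewrite morph_constt // constt_p_elt // /p_elt ot.
  split=> //; first exact: groupX.
  apply: nt_prime_order => //.
    have : (u.`_2) ^+ 2 \in B.
      apply: coset_idr; first by rewrite !groupX.
      by rewrite morphX ?groupX //= e2 -ot expg_order.
    move=> Bu2; apply/eqP; rewrite -order_eq1; apply/eqP.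
    have p2 : 2.-elt (u.`_2 ^+ 2) by rewrite p_eltX ?p_elt_constt.
    by apply: pnat_1 p2 _; rewrite -odd_2'nat (dvdn_odd (order_dvdG Bu2)).
  apply/eqP=> u1; move: ot; rewrite -e2 u1 /= coset_id ?group1 // order1 //.
move=> t u Gt Gu ot ou; have [t' [Gt' ot' <-]] := lift t Gt ot.
by have [u' [Gu' ou' <-]] := lift u Gu ou; rewrite (uG t' u').
Qed.

Lemma p_quotient_sub (p : nat) (gT : finGroupType) (H K S : {group gT}) :
  H \subset 'N(K) -> p.-group (H / K) -> p.-Sylow(H) S -> H \subset K * S.
Proof.
move=> nKH pHK sylS; have [sSH _ _] := and3P sylS.
have sylSK := quotient_pHall (subset_trans sSH nKH) sylS.
by rewrite -quotientSK // (pHall_id sylSK).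
Qed.

Lemma quad_eq_conj (gT : finGroupType) (E : {group gT}) x s :
    s \in 'N(E) -> (forall e, e \in E -> e ^ s = e ^ x) -> quad E x -> quad E s.
Proof.
move=> nEs exs /quadP qx; apply/quadP=> e Ee; rewrite -(qx e Ee).
have es : [~ e, s] = [~ e, x] by rewrite !commgEl exs.
by rewrite es [LHS]commgEl [RHS]commgEl exs // -es commgEl groupM ?groupV ?memJ_norm.
Qed.

Section Control.

Variable p : nat.
Hypotheses (p_pr : prime p) (p_odd : odd p).

(* By stability [gsW P] lies in a Sylow subgroup [Q] of the preimage of
   [O_p(G / C(B))], to whose normalizer the Frattini argument reduces. There the
   normal closure of [gsW P] is again good in [P], so [gsW P] is normal by
   maximality. *)
Lemma cent_pcore_gsW (gT : finGroupType) (G P B : {group gT}) :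
    uniq_inv G -> p.-Sylow(G) P -> B <| G -> p.-group B ->
  {in G, forall y, exists2 c, c \in 'C_G(B) & gsW P :^ y = gsW P :^ c}.
Proof.
move=> uG sylP nsBG pB; have [sPG pP _] := and3P sylP; have [sBG nBG] := andP nsBG.
set W := gsW P; have nsWP : W <| P := gsW_normal P; have [sWP nWP] := andP nsWP.
have nCG : G \subset 'N('C(B)) := subset_trans nBG (cent_norm B).
have sBP : B \subset P.
  by rewrite (subset_trans (pcore_max pB nsBG)) // pcore_sub_Hall.
pose O := (G :&: coset 'C(B) @*^-1 'O_p(G / 'C(B)))%G.
have sOG : O \subset G := subsetIl _ _.
have nsOG : O <| G.
  rewrite /normal sOG normsI ?normG //.
  by rewrite (subset_trans _ (morphpre_norm _ _)) // -sub_morphim_pre // gFnorm.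
have sWO : W \subset O.
  apply/subsetP=> w Ww; have Pw := subsetP sWP w Ww; have Gw := subsetP sPG w Pw.
  rewrite inE Gw /= inE (subsetP nCG) //= inE.
  apply: (quad_pcore p_pr p_odd pB uG) => //; first exact: mem_p_elt pP Pw.
  (* [B] lies in [P], which normalizes [W], so [[B, W]] lies in the abelian group [W]. *)
  apply/quadP=> b Bb; apply/eqP/commgP; apply: (centsP (gsW_abelian pP)) => //.
  by rewrite commgEr groupM // memJ_norm ?groupV // (subsetP nWP) // (subsetP sBP).
pose Q := (O :&: P)%G.
have nsQP : Q <| P by rewrite /normal subsetIr normsI ?normG // (subset_trans sPG) // normal_norm.
have sylQ : p.-Sylow(O) Q by apply: Sylow_setI_normal nsOG sylP.
have sOCQ : O \subset 'C(B) * Q.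
  apply: p_quotient_sub (subset_trans sOG nCG) _ sylQ.
  apply: pgroupS (pcore_pgroup p (G / 'C(B))).
  by rewrite sub_morphim_pre ?subsetIr ?(subset_trans sOG nCG).
have defG := Frattini_arg nsOG sylQ.
pose N := 'N_G(Q)%G; have sNG : N \subset G := subsetIl _ _.
have sPN : P \subset N by rewrite subsetI sPG normal_norm.
have sylPN : p.-Sylow(N) P := pHall_subl sPN sNG sylP.
have nsQN : Q <| N by rewrite /normal subsetIr andbT (subset_trans (normal_sub nsQP)).
have sWQ : W \subset Q by rewrite subsetI sWO.
pose E := <<\bigcup_(n in N) W :^ n>>%G.
have sWnE n : n \in N -> W :^ n \subset E.
  by move=> Nn; rewrite sub_gen // (bigcup_max n).
have sWE : W \subset E by rewrite -[W]conjsg1 sWnE.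
have sEQ : E \subset Q.
  rewrite gen_subG; apply/bigcupsP=> n Nn; rewrite -(normP (subsetP (normal_norm nsQN) n Nn)).
  by rewrite conjSg.
have nEN : N \subset 'N(E).
  apply: norms_gen; apply/subsetP=> m Nm; rewrite inE; apply/subsetP=> _ /imsetP[w + ->].
  case/bigcupP=> n Nn wn; apply/bigcupP; exists (n * m); first by rewrite groupM.
  by rewrite /= conjsgM memJ_conjg.
have pE : p.-group E := pgroupS (subset_trans sEQ (subsetIr _ _)) pP.
have gE : good P E.
  apply/goodP=> x Px qx; rewrite cent_gen; apply/centP=> v /bigcupP[n Nn vn].
  have Nx : x \in N := subsetP sPN x Px.
  pose x' := x ^ n^-1; have Nx' : x' \in N by rewrite groupJ ?groupV.
  have qx' : quad E x'.
    by rewrite -(normP (subsetP nEN n^-1 _)) ?groupV // quadJ.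
  have nCN := subset_trans nEN (cent_norm E).
  (* Stability on [E] puts the image of [x'] in the Sylow subgroup [P / 'C(E)], so [x'] acts on [E]
     as some [s] in [P]. Then [s] is quadratic on [W], hence centralizes it by goodness of [gsW P];
     so does [x'], and [x = x' ^ n] centralizes [W :^ n]. *)
  have Ox' : coset 'C(E) x' \in 'O_p(N / 'C(E)).
    apply: (quad_pcore p_pr p_odd pE (uniq_invS sNG uG)) => //.
      exact: subset_trans sEQ (normal_sub nsQN).
    by rewrite p_eltJ (mem_p_elt pP).
  have : coset 'C(E) x' \in P / 'C(E).
    apply: subsetP Ox'; apply: pcore_sub_Hall; apply: quotient_pHall sylPN.
    exact: subset_trans sPN nCN.
  case/morphimP=> s Ns Ps /(rcoset_kercosetP (subsetP nCN _ Nx') Ns) x's.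
  have cE e : e \in E -> e ^ x' = e ^ s.
    move=> Ee; case/rcosetP: x's => c cEc ->.
    by rewrite conjgM /conjg -(centP cEc e Ee) mulKg.
  have qs : quad W s.
    apply: quadS sWE _; apply: quad_eq_conj qx' => [|e Ee]; last by rewrite cE.
    by rewrite (subsetP nEN) // (subsetP sPN).
  have cWs := goodP _ _ (gsW_good P) s Ps qs.
  have cWx' : x' \in 'C(W).
    apply/centP=> w Ww; apply/esym/commgP/conjg_fixP; rewrite cE ?(subsetP sWE) //.
    by apply/conjg_fixP/commgP/esym/(centP cWs).
  have : x' ^ n \in 'C(W :^ n) by rewrite centJ memJ_conjg.
  by rewrite conjgKV => /centP/(_ v vn).
have sEW : E \subset W.
  by apply: gsW_max gE; rewrite /normal (subset_trans sEQ) ?subsetIr // (subset_trans sPN).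
have nWN : N \subset 'N(W).
  by apply/subsetP=> n Nn; rewrite inE (subset_trans (sWnE n Nn)).
move=> y Gy; have : y^-1 \in O * N by rewrite defG groupV.
case/mulsgP=> o n Oo Nn ey; have /mulsgP[c s Cc Qs eo] := subsetP sOCQ o Oo.
have Ps := subsetP (normal_sub nsQP) s Qs.
have Gc : c \in G.
  have [Go Gs] := (subsetP sOG o Oo, subsetP sPG s Ps).
  by rewrite -(mulgK s c) -eo groupM ?groupV.
exists c^-1; first by rewrite groupV inE Gc.
rewrite -(invgK y) ey eo !invMg !conjsgM.
rewrite (normP (subsetP nWN n^-1 _)) ?groupV //.
by rewrite (normP (subsetP nWP s^-1 _)) ?groupV.
Qed.

End Control.

Definition gsW_conj (gT : finGroupType) (G D P P' : {set gT}) :=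
  exists2 c, c \in 'C_G(D) & gsW P' = gsW P :^ c.

(** If [D] and [D :^ g] lie in [P], the choice [P' = P :^ g^-1] yields [g] in
    ['C_G(D) * 'N_G(gsW P)], the usual control of fusion. The form with two Sylow subgroups composes
    by transitivity. *)
Definition gsW_fusion (p : nat) (gT : finGroupType) (G : {group gT}) :=
  forall P P' D : {group gT}, p.-Sylow(G) P -> p.-Sylow(G) P' ->
    D \subset P -> D \subset P' -> gsW_conj G D P P'.

Section GsWConj.
Variables (gT : finGroupType) (G D : {group gT}).
Implicit Types P : {group gT}.

Lemma gsW_conj_refl P : gsW_conj G D P P.
Proof. by exists 1; rewrite ?group1 ?conjsg1. Qed.

Lemma gsW_conj_sym P P' : gsW_conj G D P P' -> gsW_conj G D P' P.
Proof. by case=> c Cc e; exists c^-1; rewrite ?groupV // e conjsgK. Qed.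

Lemma gsW_conj_trans P P1 P2 :
  gsW_conj G D P P1 -> gsW_conj G D P1 P2 -> gsW_conj G D P P2.
Proof. by case=> c Cc e1 [d Cd e2]; exists (c * d); rewrite ?groupM // e2 e1 conjsgM. Qed.

Lemma gsW_conjS (H D' : {group gT}) P P' :
  H \subset G -> D \subset D' -> gsW_conj H D' P P' -> gsW_conj G D P P'.
Proof. by move=> sHG sDD [c Cc e]; exists c => //; apply: subsetP Cc; rewrite setISS ?centS. Qed.

Lemma gsW_conjJ P P' y :
  y \in 'N_G(D) -> gsW_conj G D P P' -> gsW_conj G D (P :^ y) (P' :^ y).
Proof.
case/setIP=> Gy Ny [c /setIP[Gc Cc] e]; exists (c ^ y).
  by rewrite inE groupJ //= -(normP Ny) centJ memJ_conjg.
by rewrite !gsWJ e -!conjsgM -conjgC.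
Qed.

Lemma gsW_conj_cent P c : c \in 'C_G(D) -> gsW_conj G D P (P :^ c).
Proof. by exists c; rewrite // gsWJ. Qed.

End GsWConj.

(** * The inductive step: smaller groups, and larger subgroups [D] of the same group *)

Section Fusion.

Variables (p : nat) (gT : finGroupType) (G : {group gT}).
Hypotheses (p_pr : prime p) (p_odd : odd p) (uG : uniq_inv G).
Hypothesis IHG : forall (rT : finGroupType) (H : {group rT}),
  #|H| < #|G| -> uniq_inv H -> gsW_fusion p H.

Lemma gsW_fusion_proper (H P P' D : {group gT}) : H \proper G ->
  p.-Sylow(H) P -> p.-Sylow(H) P' -> D \subset P -> D \subset P' -> gsW_conj G D P P'.
Proof.
move=> ltHG sylP sylP' sDP sDP'; have sHG := proper_sub ltHG.
apply: (gsW_conjS sHG (subxx _)).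
by apply: (IHG _ (uniq_invS sHG uG)) => //; apply: proper_card.
Qed.

Variable D : {group gT}.
Hypothesis IHD : forall D' : {group gT}, #|D| < #|D'| -> forall P P' : {group gT},
  p.-Sylow(G) P -> p.-Sylow(G) P' -> D' \subset P -> D' \subset P' -> gsW_conj G D' P P'.

Let B := 'O_p(G)%G.
Let C := 'C_G(B)%G.

(* [T] is enlarged inside the normalizer of [gsW T] until it is a Sylow subgroup,
   correcting [y] by elements of [C_G(D)] along the way. *)
Lemma gsW_conj_norm_trivial_core (T P : {group gT}) y :
    B :=: 1 -> D :!=: 1 -> D \proper T -> T \subset P -> p.-Sylow(G) P ->
    y \in 'N_G(D) -> y \in 'N(gsW T) ->
  gsW_conj G D P (P :^ y).
Proof.
move=> B1 ntD; have [n] := ubnP (#|G| - #|T|); elim: n => // n IHn in T P y *.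
move=> ltn prDT sTP sylP NDy NWy; have [sPG pP _] := and3P sylP.
have [Gy Ny] := setIP NDy; have sDT := proper_sub prDT.
have [eqTP | neqTP] := eqVneq T P.
  by exists 1; rewrite ?group1 // gsWJ conjsg1 -eqTP (normP NWy).
have prTP : T \proper P by rewrite properEneq neqTP.
have pT := pgroupS sTP pP.
have ntT : T :!=: 1 by apply: contraNneq ntD => T1; rewrite -subG1 -T1.
pose Y := 'N_G(gsW T)%G; have sYG : Y \subset G := subsetIl _ _.
have prY : Y \proper G.
  rewrite properEneq sYG andbT; apply: contraNneq (gsW_neq1 pT ntT) => eYG.
  rewrite -subG1 -B1 pcore_max ?(pgroupS (gsW_sub T)) //.
  by rewrite /normal (subset_trans (gsW_sub T)) ?(subset_trans sTP) // -{1}eYG subsetIr.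
have prN : T \proper 'N_P(T) := nilpotent_proper_norm (pgroup_nil pP) prTP.
have sNY : 'N_P(T) \subset Y by rewrite setISS // gsW_norm.
have [T2 sylT2 sNT2] := Sylow_superset sNY (pgroupS (subsetIl _ _) pP).
have [sT2Y pT2 _] := and3P sylT2.
have prT2 : T \proper T2 := proper_sub_trans prN sNT2.
have Yy : y \in Y by rewrite inE Gy.
have sDT2 : D \subset T2 := subset_trans sDT (proper_sub prT2).
have [c Cc eW] : gsW_conj G D T2 (T2 :^ y)%G.
  apply: (gsW_fusion_proper prY) => //; first by rewrite pHallJ.
  by rewrite -(normP Ny) conjSg.
have [Gc CDc] := setIP Cc.
have [P2 sylP2 sT2P2] := Sylow_superset (subset_trans sT2Y sYG) pT2.
pose y' := y * c^-1.
have P2y : gsW_conj G D P2 (P2 :^ y').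
  apply: (IHn T2) => //.
  - have ltT2 := proper_card prT2.
    have leT2 := subset_leq_card (subset_trans sT2Y sYG).
    rewrite -ltnS (leq_trans _ ltn) // ltnS ltn_sub2l //.
    exact: leq_trans ltT2 leT2.
  - exact: sub_proper_trans sDT prT2.
  - by rewrite groupM // groupV inE Gc (subsetP (cent_sub D)).
  by apply/normP; rewrite conjsgM -gsWJ eW conjsgK.
have P2y1 : gsW_conj G D P2 (P2 :^ y)%G.
  apply: gsW_conj_trans P2y _.
  by have := @gsW_conj_cent _ _ _ (P2 :^ y')%G c Cc; rewrite /= -conjsgM mulgKV.
have PP2 : gsW_conj G D P P2.
  apply: (@gsW_conjS _ G D G T) => //; apply: IHD => //; first exact: proper_card.
  exact: subset_trans (proper_sub prT2) sT2P2.
apply: (@gsW_conj_trans _ _ _ _ P2 (P :^ y)%G) => //.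
apply: (@gsW_conj_trans _ _ _ _ (P2 :^ y)%G) => //.
by apply: gsW_conjJ => //; apply: gsW_conj_sym.
Qed.


Let nsBG : B <| G := pcore_normal p G.
Let pB : p.-group B := pcore_pgroup p G.
Let nsCG : C <| G.
Proof. by rewrite /normal subsetIl normsI ?normG // norms_cent // normal_norm. Qed.

(** Being normal, [P :&: C] lies in [B], which [C] centralizes; so [C] is the direct product of
    [P :&: C] and a [p']-group [F]. Hence [cent_pcore_gsW] conjugates [gsW P] to [gsW P :^ y] by
    some [f] in [F]. What remains is to replace [f] by an element of [F] that also centralizes
    [D]. *)
Lemma gsW_conj_norm_central (P : {group gT}) y :
    p.-Sylow(G) P -> D \subset P -> y \in 'N_G(D) -> P :&: C <| G ->
  gsW_conj G D P (P :^ y).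
Proof.
move=> sylP sDP NDy nsTG; have [sPG pP _] := and3P sylP; have [Gy Ny] := setIP NDy.
have sBP : B \subset P := pcore_sub_Hall sylP.
set W := gsW P; have [sWP nWP] := andP (gsW_normal P); have pW := pgroupS sWP pP.
pose TC := (C :&: P)%G; rewrite setIC -/TC in nsTG.
have sTB : TC \subset B.
  by apply: pcore_max; rewrite // (pgroupS _ pP) ?subsetIr.
have sylTC : p.-Sylow(C) TC by apply: Sylow_setI_normal nsCG sylP.
have nsTC : TC <| C by apply: normalS nsTG; rewrite ?subsetIl ?normal_sub.
have [F0 compF0] := splitsP (SchurZassenhaus_split (pHall_Hall sylTC) nsTC).
have [tiTF defC] := complP compF0.
have hallF0 : p^'.-Hall(C) F0 by rewrite -(compl_pHall _ sylTC).
have sF0C : F0 \subset C := pHall_sub hallF0.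
have cTF0 : F0 \subset 'C(TC).
  by rewrite (subset_trans sF0C) // (subset_trans (subsetIr _ _)) // centS.
have nsF0C : F0 <| C.
  rewrite /normal sF0C -defC mul_subG ?normG // cents_norm // centsC //.
pose F := 'O_p^'(C)%G; have eqF : F :=: F0 := normal_Hall_pcore hallF0 nsF0C.
have nsFG : F <| G := gFnormal_trans _ nsCG.
have p'F : p^'.-group F := pcore_pgroup _ _.
have [c Cc eWc] := cent_pcore_gsW p_pr p_odd uG sylP nsBG pB Gy.
have /mulsgP[t f Tt Ff ec] : c \in TC * F by rewrite eqF defC.
have {}eWc : W :^ y = W :^ f.
  rewrite /W eWc ec conjsgM (normP (subsetP nWP t _)) //.
  by rewrite (subsetP sBP) // (subsetP sTB).
have Gf : f \in G by rewrite (subsetP (normal_sub nsFG)).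
have nFG := normal_norm nsFG.
pose X := (D <*> W)%G; have sXP : X \subset P by rewrite join_subG sDP.
have pX := pgroupS sXP pP; have nFX := subset_trans (subset_trans sXP sPG) nFG.
have nFW := subset_trans (subset_trans sWP sPG) nFG.
pose FX := (F <*> X)%G; pose FW := (F <*> W)%G.
have eqFX : F * X = FX by rewrite -norm_joinEr.
have eqFW : F * W = FW by rewrite -norm_joinEr.
have [_ sylX] := coprime_mulGp_Hall eqFX p'F pX.
have [_ sylW] := coprime_mulGp_Hall eqFW p'F pW.
have sWfFW : W :^ f \subset FW.
  have FWf : f \in FW by rewrite (subsetP (joing_subl _ _)).
  by rewrite -(conjGid FWf) conjSg joing_subr.
have sFWX : FW \subset FX by rewrite genS ?setUS // joing_subr.
have eX' : X :^ y = D <*> W :^ f by rewrite /= -genJ conjUg (normP Ny) eWc.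
have sX'FX : X :^ y \subset FX.
  rewrite eX' join_subG (subset_trans sWfFW sFWX) andbT.
  by rewrite (subset_trans _ (joing_subr F X)) ?joing_subl.
have sylX' : p.-Sylow(FX) (X :^ y)%G.
  by rewrite pHallE sX'FX cardJg (card_Hall sylX) /=.
(* Both are Sylow subgroups of [F * X], so some [f1] in [F] conjugates [X] to [X :^ y]. For [d] in
   [D], the commutator [[~ d, f1]] lies in [X :^ y :&: F = 1]. *)
have [g FXg eg] := Sylow_trans sylX sylX'.
have /mulsgP[x f1 Xx Ff1 eg1] : g \in X * F by rewrite (normC nFX) eqFX.
have {}eg : X :^ y = X :^ f1 by rewrite eg eg1 conjsgM conjGid.
have tiXF : (X :^ y) :&: F = 1.
  by apply: coprime_TIg; rewrite cardJg (pnat_coprime pX).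
have Gf1 : f1 \in G by rewrite (subsetP (normal_sub nsFG)).
exists f1.
  rewrite inE Gf1; apply/centP=> d Dd; apply/esym/commgP.
  rewrite -in_set1 -[[set 1]]tiXF inE; apply/andP; split.
    rewrite commgEl groupM // ?groupV /=; first by rewrite eX' mem_gen // inE Dd.
    by rewrite eg memJ_conjg mem_gen // inE Dd.
  rewrite commgEr groupM // memJ_norm ?groupV // (subsetP nFG) //.
  by rewrite (subsetP sPG) // (subsetP sDP).
(* [W :^ f] and [W :^ f1] both lie in the [p]-subgroup [I] of [F * W], whose order is at most
   [#|W|], so they coincide. *)
rewrite gsWJ -/W eWc; pose I := (X :^ y :&: FW)%G.
have pI : p.-group I by rewrite (pgroupS (subsetIl _ _)) // pgroupJ.
have leI : #|I| <= #|W|.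
  have [z _ sIW] := Sylow_Jsub sylW (subsetIr _ _ : I \subset FW) pI.
  by rewrite -(cardJg I z) subset_leq_card.
have eqI h : W :^ h \subset I -> W :^ h = I.
  by move=> sWI; apply/eqP; rewrite eqEcard sWI cardJg.
have sWf1I : W :^ f1 \subset I.
  rewrite subsetI /= eg conjSg joing_subr /=.
  have FWf : f1 \in FW by rewrite (subsetP (joing_subl _ _)).
  by rewrite -(conjGid FWf) conjSg joing_subr.
have sWfI : W :^ f \subset I by rewrite subsetI sWfFW /= eX' joing_subr.
exact: etrans (eqI f sWfI) (esym (eqI f1 sWf1I)).
Qed.

(** As [g] centralizes [b = [~ d, g]], induction gives [d ^ (g ^+ n) = d * b ^+ n], so the order of
    the [p]-element [b] divides that of [g]. *)
Lemma stable_pair_p'elt (A H : {group gT}) g :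
    p.-group H -> p^'.-elt g -> g \in 'C(H) -> (forall d, d \in A -> [~ d, g] \in H) ->
  g \in 'C(A).
Proof.
move=> pH p'g cHg sgH; apply/centP=> d Ad; apply/esym/commgP/eqP.
have Hb := sgH d Ad; set b := [~ d, g] in Hb *.
have dX n : d ^ (g ^+ n) = d * b ^+ n.
  elim: n => [|n IHn]; first by rewrite conjg1 mulg1.
  have bg : b ^ g = b by apply/conjg_fixP/commgP/esym/(centP cHg).
  by rewrite expgSr conjgM IHn conjMg conjXg bg conjg_mulR -mulgA -expgS.
have := dX #[g]; rewrite expg_order conjg1 -{1}[d]mulg1 => /mulgI/esym/eqP.
rewrite -order_dvdn => dvd_b; apply/eqP; rewrite -order_eq1; apply/eqP.
by apply: pnat_1 (mem_p_elt pH Hb) (pnat_dvd dvd_b p'g).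
Qed.

(** Induction in [G / B] gives an element [c] centralizing [D] only modulo [B]. Since [P * C = G],
    the [p']-elements of [CS] lie in [C], so they centralize [B] and then [D]. Thus [CS] is
    ['C_G(D)] times a subgroup of [P], and [P] normalizes the preimage [L] of [gsW (P / B)]; so [c]
    can be traded for an element of ['C_G(D)], and the rest takes place in the proper subgroup
    ['N_G(L)]. *)
Lemma gsW_conj_norm_full (T P : {group gT}) y :
    p.-Sylow(G) P -> p.-Sylow('N_G(D)) T -> T \subset P -> D \subset P ->
    y \in 'N_G(D) -> B :!=: 1 -> B \subset D -> B \proper P -> P * C = G ->
  gsW_conj G D P (P :^ y).
Proof.
move=> sylP sylT sTP sDP NDy ntB sBD prBP defG.
have [sPG pP _] := and3P sylP; have [Gy Ny] := setIP NDy.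
have [sBG nBG] := andP nsBG; have sBP := proper_sub prBP.
have nsBP : B <| P := normalS sBP sPG nsBG.
have nBP := subset_trans sPG nBG; have nBD := subset_trans sDP nBP.
have By := subsetP nBG y Gy.
have ltGB : #|G / B| < #|G| by rewrite ltn_quotient.
have uGB : uniq_inv (G / B).
  by apply: uniq_inv_quotient => //; apply: odd_pgroup_odd p_odd pB.
have sylPB : p.-Sylow(G / B) (P / B) by apply: quotient_pHall.
pose yB := coset B y.
have [cB CcB ecB] : gsW_conj (G / B) (D / B) (P / B) ((P / B) :^ yB).
  apply: (IHG ltGB uGB (P' := ((P / B) :^ yB)%G)) => //.
  - by rewrite pHallJ // mem_quotient.
  - exact: quotientS.
  by rewrite /= /yB -quotientJ // -{1}(normP Ny) quotientS // conjSg.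
pose W' := gsW (P / B); rewrite gsWJ -/W' in ecB.
have pPB : p.-group (P / B) := quotient_pgroup _ pP.
have ntPB : P / B != 1 by rewrite -subG1 quotient_sub1 // proper_subn.
pose L := (coset B @*^-1 W')%G.
have nsLP : L <| P.
  by rewrite -(quotientGK nsBP) cosetpre_normal gsW_normal.
have [sLP nLP] := andP nsLP; have pL := pgroupS sLP pP.
have LJ g : g \in G -> L :^ g = coset B @*^-1 (W' :^ coset B g).
  by move=> Gg; rewrite morphpreJ // (subsetP nBG).
have LB : L / B = W' by rewrite cosetpreK.
have prNL : 'N_G(L) \proper G.
  rewrite properEneq subsetIl andbT; apply: contraNneq (gsW_neq1 pPB ntPB) => eNG.
  rewrite -/W' -LB -subG1 quotient_sub1 ?(subset_trans sLP nBP) // pcore_max //.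
  by rewrite /normal (subset_trans sLP sPG) -{1}eNG subsetIr.
pose CS := (G :&: coset B @*^-1 'C(D / B))%G.
have [c Nc Gc ec] := morphimP (subsetP (subsetIl _ _) _ CcB).
have CSc : c \in CS.
  by rewrite inE Gc; apply/morphpreP; rewrite -ec; split=> //; case/setIP: CcB.
have CSD g d : g \in CS -> d \in D -> [~ d, g] \in B.
  case/setIP=> Gg /morphpreP[Ng /centP cg] Dd.
  have Nd := subsetP nBD d Dd.
  apply: coset_idr; first by rewrite groupR.
  by rewrite morphR //=; apply/eqP/commgP/esym/cg; rewrite mem_quotient.
have nDCS : CS \subset 'N(D).
  apply/subsetP=> g CSg; rewrite inE; apply/subsetP=> _ /imsetP[d Dd ->].
  by rewrite conjg_mulR groupM // (subsetP sBD) // CSD.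
have nsCS : CS <| 'N_G(D).
  rewrite /normal subsetI subsetIl nDCS normsI //; first by rewrite (subset_trans (subsetIl _ _)) ?normG.
  have nBN : 'N_G(D) \subset 'N(B) := subset_trans (subsetIl _ _) nBG.
  apply: subset_trans (morphpre_norm _ _); rewrite -sub_morphim_pre //.
  apply: subset_trans (cent_norm _); apply: quotient_norms; exact: subsetIr.
have sylCT : p.-Sylow(CS) (CS :&: T)%G by apply: Sylow_setI_normal nsCS sylT.
have nCCS : CS \subset 'N('C_G(D)).
  apply: normsI; last exact: norms_cent.
  exact: subset_trans (subsetIl _ _) (normG G).
have sCS : CS \subset 'C_G(D) * (CS :&: T).
  apply: (p_quotient_sub nCCS _ sylCT); apply: pgroup_p'elt => // t CSt p't.
  have Gt : t \in G by case/setIP: CSt.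
  rewrite inE Gt; apply: (stable_pair_p'elt pB p't) => [|d Dd]; last exact: CSD.
  have nCG := normal_norm nsCG.
  have pGC : p.-group (G / C) by rewrite -defG quotientMidr quotient_pgroup.
  have : t \in C; last by case/setIP.
  apply: coset_idr; first exact: subsetP nCG t Gt.
  have pCt : p.-elt (coset C t) := mem_p_elt pGC (mem_quotient C Gt).
  have p'Ct : p^'.-elt (coset C t) by apply: morph_p_elt p't; apply: subsetP nCG t Gt.
  by apply/eqP; rewrite -order_eq1 (pnat_1 pCt p'Ct).
have /mulsgP[k s CDk CTs eck] : c^-1 \in 'C_G(D) * (CS :&: T) by rewrite (subsetP sCS) ?groupV.
have Ps : s \in P by case/setIP: CTs => _ /(subsetP sTP).
have {}eck : c = s^-1 * k^-1 by rewrite -invMg -eck invgK.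
have [Gk CDk'] := setIP CDk.
pose y' := y * k.
have Gy' : y' \in G by rewrite groupM.
have NLy' : y' \in 'N(L).
  apply/normP; rewrite conjsgM LJ // -/yB ecB ec -LJ // eck conjsgM.
  by rewrite (normP (subsetP nLP s^-1 _)) ?groupV // -conjsgM mulVg conjsg1.
have sPNL : P \subset 'N_G(L) by rewrite subsetI sPG.
have sylPL : p.-Sylow('N_G(L)) P := pHall_subl sPNL (subsetIl _ _) sylP.
have Py' : gsW_conj G D P (P :^ y').
  apply: (gsW_fusion_proper (P' := (P :^ y')%G) prNL) => //.
    by rewrite pHallJ // inE Gy'.
  have /normP <- : y' \in 'N(D) by rewrite groupM // (subsetP (cent_sub D)).
  by rewrite conjSg.
apply: (@gsW_conj_trans _ _ _ _ (P :^ y')%G (P :^ y)%G) => //.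
have := @gsW_conj_cent _ G D (P :^ y')%G k^-1.
by rewrite groupV /= -conjsgM mulgK; apply.
Qed.

(** If [P :&: C] lies in [D], it equals [C :&: D], which [y] normalizes: it is normal in [G], or its
    normalizer is a proper subgroup containing [P] and [y]. Otherwise [D1] is larger than [D] and
    Sylow in [D * C], so some [c] in [C] makes [y * c] normalize [D1]. The hypothesis on larger
    subgroups links [P] to [P :^ (y * c)], which is linked to [P :^ y] inside the proper subgroup
    [(P * C) :^ y]. *)
Lemma gsW_conj_norm_proper (P : {group gT}) y :
    p.-Sylow(G) P -> D \subset P -> y \in 'N_G(D) -> P * C != G ->
  gsW_conj G D P (P :^ y).
Proof.
move=> sylP sDP NDy neqPC; have [sPG pP _] := and3P sylP; have [Gy Ny] := setIP NDy.
have [sCG nCG] := andP nsCG; have nCP := subset_trans sPG nCG.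
have sylJ z : z \in G -> p.-Sylow(G) (P :^ z)%G by move=> Gz; rewrite pHallJ.
have sDPy : D \subset P :^ y by rewrite -(normP Ny) conjSg.
pose TC := (C :&: P)%G; have sylTC : p.-Sylow(C) TC := Sylow_setI_normal nsCG sylP.
pose D1 := (D <*> TC)%G.
have sD1P : D1 \subset P by rewrite join_subG sDP subsetIr.
have sDD1 : D \subset D1 := joing_subl _ _.
have [sTD | not_sTD] := boolP (TC \subset D).
  have eT : TC :=: C :&: D.
    by apply/eqP; rewrite eqEsubset subsetI subsetIl sTD setIS.
  have NTy : y \in 'N(TC).
    by apply/normP; rewrite eT conjIg (normP Ny) (normP (subsetP nCG y Gy)).
  have sPN : P \subset 'N_G(TC) by rewrite subsetI sPG normsI ?normG.
  have sylPN : p.-Sylow('N_G(TC)) P := pHall_subl sPN (subsetIl _ _) sylP.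
  have [eNG | neqNG] := eqVneq 'N_G(TC) G.
    apply: gsW_conj_norm_central => //; rewrite setIC /normal subIset ?sCG //=.
    by rewrite -{1}eNG subsetIr.
  have prN : 'N_G(TC) \proper G by rewrite properEneq neqNG subsetIl.
  by apply: (gsW_fusion_proper (P' := (P :^ y)%G) prN) => //; rewrite pHallJ // inE Gy.
have ltD : #|D| < #|D1|.
  rewrite proper_card // properE sDD1 join_subG subxx /= //.
pose DC := (D <*> C)%G; have nCD := subset_trans sDP nCP.
have sD1DC : D1 \subset DC by rewrite join_subG joing_subl (subset_trans (subsetIl _ _)) ?joing_subr.
have eDC : D1 * C = DC.
  have nCD1 := subset_trans sD1P nCP.
  rewrite -norm_joinEl //; apply/eqP; rewrite eqEsubset; apply/andP; split.
    by rewrite join_subG sD1DC joing_subr.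
  by rewrite join_subG joing_subr (subset_trans sDD1) ?joing_subl.
have sylD1 : p.-Sylow(DC) D1.
  rewrite /pHall sD1DC (pgroupS sD1P pP) -eDC indexMg.
  apply: pnat_dvd (indexgS C (joing_subr D TC)) _.
  by case/and3P: sylTC.
have sylD1y : p.-Sylow(DC) (D1 :^ y)%G.
  have NDCy : y \in 'N(DC).
    have nND : 'N_G(D) \subset 'N(DC).
      by rewrite normsY ?subsetIr // (subset_trans (subsetIl _ _)).
    exact: subsetP nND y NDy.
  by rewrite -{1}(normP NDCy) pHallJ2.
have [u DCu eu] := Sylow_trans sylD1y sylD1.
have /mulsgP[c d Cc Dd euc] : u \in C * D by rewrite -norm_joinEr // joingC.
have eD1 : D1 :^ (y * c) = D1.
  rewrite conjsgM -{2}(conjsgK d D1) -(conjsgK d (_ :^ c)); congr (_ :^ _).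
  rewrite -conjsgM -euc -eu.
  by rewrite conjGid // (subsetP sDD1).
have Gc := subsetP sCG c Cc.
have sylPyc := sylJ _ (groupM Gy Gc).
have PPyc : gsW_conj G D P (P :^ (y * c)).
  apply: (@gsW_conjS _ G D G D1 P (P :^ (y * c))%G) => //; apply: IHD => //.
  by rewrite -{1}eD1 conjSg.
apply: (@gsW_conj_trans _ _ _ _ (P :^ (y * c))%G (P :^ y)%G) => //.
pose H := ((P <*> C) :^ y)%G.
have prH : H \proper G.
  rewrite -(conjGid Gy) /= properJ properEneq join_subG sPG sCG /= andbT.
  by rewrite norm_joinEl.
have sPyH : P :^ y \subset H by rewrite conjSg joing_subl.
have Hc : c \in H.
  by rewrite mem_conjg (subsetP (joing_subr P C)) // memJ_norm ?groupV // (subsetP nCG).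
have sylPyH := pHall_subl sPyH (proper_sub prH) (sylJ y Gy).
apply: (gsW_fusion_proper (P := (P :^ (y * c))%G) (P' := (P :^ y)%G) prH) => //.
  by rewrite /= conjsgM pHallJ.
by rewrite (subset_trans sDD1) // -{1}eD1 conjSg.
Qed.

Lemma gsW_conj_norm (T P : {group gT}) y :
    p.-Sylow(G) P -> p.-Sylow('N_G(D)) T -> T \subset P -> D \proper T ->
    y \in 'N_G(D) ->
  gsW_conj G D P (P :^ y).
Proof.
move=> sylP sylT sTP prDT NDy; have [sPG pP _] := and3P sylP.
have [Gy Ny] := setIP NDy; have sDT := proper_sub prDT; have sDP := subset_trans sDT sTP.
have sBP : B \subset P := pcore_sub_Hall sylP.
have sylPy : p.-Sylow(G) (P :^ y)%G by rewrite pHallJ.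
have sDPy : D \subset P :^ y by rewrite -(normP Ny) conjSg.
have [sBD | not_sBD] := boolP (B \subset D); last first.
  have sBPy : B \subset P :^ y by rewrite -(normP (subsetP (normal_norm nsBG) y Gy)) conjSg.
  apply: (@gsW_conjS _ G D G (D <*> B)%G P (P :^ y)%G); rewrite ?joing_subl //.
  apply: IHD; rewrite ?join_subG ?sDP ?sDPy // proper_card //.
  by rewrite properE joing_subl join_subG subxx.
have [B1 | ntB] := eqVneq B 1%G; last first.
  have [ePC | nePC] := eqVneq (P * C) G; last exact: gsW_conj_norm_proper.
  apply: (gsW_conj_norm_full sylP sylT) => //.
  exact: sub_proper_trans sBD (proper_sub_trans prDT sTP).
have [D1 | ntD] := eqVneq D 1%G.
  by exists y; rewrite ?gsWJ // inE Gy D1 /= cent1T inE.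
have prN : 'N_G(D) \proper G.
  rewrite properEneq subsetIl andbT; apply: contraNneq ntD => eNG.
  have pD := pgroupS sDP pP.
  apply/eqP/group_inj/trivgP; rewrite /= -[1]/(gval 1%G) -B1 pcore_max //.
  by rewrite /normal (subset_trans sDP) // -{1}eNG subsetIr.
have sDTy : D \subset T :^ y by rewrite -(normP Ny) conjSg.
have [c Cc eW] : gsW_conj G D T (T :^ y)%G.
  by apply: (gsW_fusion_proper prN) => //; rewrite pHallJ.
have [Gc CDc] := setIP Cc.
pose y' := y * c^-1.
have NDy' : y' \in 'N_G(D).
  by rewrite groupM // groupV inE Gc (subsetP (cent_sub D)).
have Py' : gsW_conj G D P (P :^ y').
  apply: (gsW_conj_norm_trivial_core (T := T)) => //; first by rewrite B1.
  by apply/normP; rewrite conjsgM -gsWJ eW conjsgK.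
apply: (@gsW_conj_trans _ _ _ _ (P :^ y')%G (P :^ y)%G) => //.
have := @gsW_conj_cent _ G D (P :^ y')%G c Cc.
by rewrite /= -conjsgM mulgKV.
Qed.

(** Through ['N_Q(D)], which is larger than [D], each Sylow subgroup is replaced by one containing a
    Sylow subgroup of ['N_G(D)]. Two such are related by some [y] in ['N_G(D)], up to another use of
    the hypothesis on larger subgroups. *)
Lemma gsW_conj_step (P P' : {group gT}) :
    p.-Sylow(G) P -> p.-Sylow(G) P' -> D \subset P -> D \subset P' ->
  gsW_conj G D P P'.
Proof.
move=> sylP sylP' sDP sDP'.
have [eDP | neDP] := eqVneq D P.
  have <- : P :=: P'.
    by apply/eqP; rewrite eqEcard -{1}eDP sDP' (card_Hall sylP) (card_Hall sylP') /=.
  exact: gsW_conj_refl.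
have neDP' : D != P'.
  apply: contraNneq neDP => eDP'; apply/eqP/group_inj/eqP.
  by rewrite eqEcard sDP eDP' (card_Hall sylP) (card_Hall sylP') /=.
have up (Q : {group gT}) : p.-Sylow(G) Q -> D \subset Q -> D != Q ->
    exists T R : {group gT}, [/\ p.-Sylow('N_G(D)) T, p.-Sylow(G) R, T \subset R,
      D \proper T & gsW_conj G D Q R].
  move=> sylQ sDQ neDQ; have [sQG pQ _] := and3P sylQ.
  have prN : D \proper 'N_Q(D).
    by apply: nilpotent_proper_norm (pgroup_nil pQ) _; rewrite properEneq neDQ.
  have [T sylT sNT] := Sylow_superset (setSI 'N(D) sQG) (pgroupS (subsetIl _ _) pQ).
  have [sTN pT _] := and3P sylT.
  have [R sylR sTR] := Sylow_superset (subset_trans sTN (subsetIl _ _)) pT.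
  exists T, R; split=> //; first exact: proper_sub_trans prN sNT.
  apply: (@gsW_conjS _ G D G 'N_Q(D)%G Q R); rewrite ?(proper_sub prN) //.
  by apply: IHD; rewrite ?(proper_card prN) ?subsetIl // (subset_trans sNT).
have [T [R [sylT sylR sTR prT PR]]] := up P sylP sDP neDP.
have [T' [R' [sylT' sylR' sTR' prT' PR']]] := up P' sylP' sDP' neDP'.
have [y NDy eT'] := Sylow_trans sylT sylT'.
apply: gsW_conj_trans PR _; apply: gsW_conj_trans _ (gsW_conj_sym PR').
have [Gy Ny] := setIP NDy.
apply: (@gsW_conj_trans _ G D R (R :^ y)%G R').
  exact: (gsW_conj_norm sylR sylT sTR prT NDy).
apply: (@gsW_conjS _ G D G T'); rewrite ?(proper_sub prT') //.
by apply: IHD; rewrite ?(proper_card prT') ?pHallJ // eT' conjSg.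
Qed.

End Fusion.

Theorem gsW_fusionP (p : nat) (gT : finGroupType) (G : {group gT}) :
  prime p -> odd p -> uniq_inv G -> gsW_fusion p G.
Proof.
move=> p_pr p_odd; have [n] := ubnP #|G|; elim: n => // n IHn in gT G *.
move=> leGn uG P P' D; have [m] := ubnP (#|G| - #|D|).
elim: m => // m IHm in P P' D *.
move=> ltDm sylP sylP' sDP sDP'.
apply: (gsW_conj_step p_pr p_odd uG) => // [rT H ltHG uH|D' ltDD' Q Q' sylQ sylQ' sDQ sDQ'].
  by apply: IHn uH; apply: leq_trans ltHG _.
apply: IHm => //; rewrite -ltnS (leq_trans _ ltDm) // ltnS ltn_sub2l //.
apply: leq_trans ltDD' (subset_leq_card (subset_trans sDQ _)).
exact: pHall_sub sylQ.
Qed.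

(** * The offender bound *)

Definition cd_measure (gT : finGroupType) (A X : {set gT}) := (#|X| * #|'C_A(X)|)%N.

Lemma cd_measure_submodular (gT : finGroupType) (A X Y : {group gT}) :
  cd_measure A X * cd_measure A Y <= cd_measure A (X :&: Y) * cd_measure A (X <*> Y).
Proof.
rewrite /cd_measure mulnACA [leqRHS]mulnACA (mul_cardG X) (mul_cardG 'C_A(X)) leq_mul //.
  by rewrite mulnC leq_mul // subset_leq_card // mulG_subG joing_subl joing_subr.
rewrite leq_mul ?subset_leq_card //; last by rewrite centY setIIr.
apply/subsetP=> _ /mulsgP[a b /setIP[Aa Xa] /setIP[Ab Yb] ->].
rewrite inE groupM //= groupM //.
  exact: subsetP (centS (subsetIl X Y)) a Xa.
exact: subsetP (centS (subsetIr X Y)) b Yb.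
Qed.

Lemma cd_measureJ (gT : finGroupType) (A X : {set gT}) g :
  cd_measure (A :^ g) (X :^ g) = cd_measure A X.
Proof. by rewrite /cd_measure centJ -conjIg !cardJg. Qed.

Lemma dvdn_pnat_ltn (p a b : nat) : prime p -> p.-nat a -> p.-nat b -> a < b -> p * a %| b.
Proof.
move=> p_pr /p_natP[i ->] /p_natP[j ->]; rewrite ltn_exp2l ?prime_gt1 // => ltij.
by rewrite -expnS dvdn_exp2l.
Qed.

(** If every orbit of [Y] outside [B] were longer than [#|B|], all these lengths, being powers of
    [p], would be divisible by [p * #|B|]. So is [#|A|], hence [#|B|] would be too. *)
Lemma small_orbit_outside (p : nat) (gT : finGroupType) (A B Y : {group gT}) :
    prime p -> p.-group A -> p.-group Y -> B \proper A -> Y \subset 'N(A) -> Y \subset 'N(B) ->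
  exists2 n, n \in A :\: B & #|Y : 'C_Y[n]| <= #|B|.
Proof.
move=> p_pr pA pY prBA nAY nBY; apply/exists_inP; apply/exists_inPn => big.
have pB := pgroupS (proper_sub prBA) pA.
have actY : [acts Y, on A :\: B | 'J].
  apply/subsetP=> y Yy; rewrite !inE; apply/subsetP=> a; rewrite !inE.
  by rewrite !memJ_norm ?(subsetP nAY) ?(subsetP nBY).
have : p * #|B| %| #|A :\: B|.
  rewrite -(acts_sum_card_orbit actY); apply: dvdn_sum => _ /imsetP[n ABn ->].
  rewrite card_orbit astab1J; apply: dvdn_pnat_ltn; rewrite ?ltnNge ?big //.
  exact: pnat_dvd (dvdn_indexg _ _) pY.
rewrite cardsD (setIidPr (proper_sub prBA)) dvdn_subr ?subset_leq_card ?proper_sub //; last first.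
  by apply: dvdn_pnat_ltn; rewrite ?proper_card.
move/(dvdn_leq (cardG_gt0 B)); rewrite leqNgt -{1}[#|B|]mul1n ltn_pmul2r //.
by rewrite prime_gt1.
Qed.

Definition sylow_transitive (p : nat) (gT : finGroupType) (H A : {group gT}) :=
  [/\ p.-group A, abelian A, H \subset 'N(A),
      {in A^#, forall n, p.-Sylow(H) 'C_H[n]}
    & {in A^# &, forall n l, exists2 h, h \in H & l = n ^ h}].

(** * The inductive step of the bound: blocks and subgroups of maximal measure *)

Section Offender.

Variables (p : nat) (gT : finGroupType) (H A : {group gT}).
Hypotheses (p_pr : prime p) (p_odd : odd p) (uH : uniq_inv H).
Hypothesis trHA : sylow_transitive p H A.
Hypothesis IHA : forall H1 A1 : {group gT}, #|A1| < #|A| -> uniq_inv H1 ->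
  sylow_transitive p H1 A1 ->
  {in A1^#, forall n (X : {group gT}), X \subset 'C_H1[n] ->
    cd_measure A1 X <= #|'C_X(A1)| * #|A1|}.

Let R := 'C_H(A)%G.
Let Q n := 'C_H[n]%G.
(** [R] is the kernel of the action on [A], so the functor is applied to a stabilizer in the
    faithful quotient. [A1 n] will be the block of [n], and [R1 n] fixes it pointwise. *)
Let L n := (coset R @*^-1 gsW (Q n / R))%G.
Let A1 n := 'C_A(L n)%G.
Let R1 n := 'C_H(A1 n)%G.
Let m := cd_measure A.

Let pA : p.-group A. Proof. by case: trHA. Qed.
Let abA : abelian A. Proof. by case: trHA. Qed.
Let nAH : H \subset 'N(A). Proof. by case: trHA. Qed.
Let sylQ n : n \in A^# -> p.-Sylow(H) (Q n). Proof. by case: trHA => _ _ _ s _; apply: s. Qed.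
Let trA n l : n \in A^# -> l \in A^# -> exists2 h, h \in H & l = n ^ h.
Proof. by case: trHA => _ _ _ _ t; apply: t. Qed.

Let nsRH : R <| H.
Proof. by rewrite /normal subsetIl normsI ?normG // norms_cent. Qed.

Let sRQ n : n \in A^# -> R \subset Q n.
Proof.
case/setD1P=> _ An; have : 'C(A) \subset 'C[n] by rewrite -cent_set1 centS // sub1set.
exact: setIS.
Qed.

Let nsRQ n : n \in A^# -> R <| Q n.
Proof. by move=> An; apply: normalS nsRH; rewrite ?sRQ ?subsetIl. Qed.

Let QJ n h : h \in H -> Q (n ^ h) :=: Q n :^ h.
Proof. by move=> Hh; rewrite /= conjIg cent1J conjGid. Qed.

Let LJ n h : h \in H -> L (n ^ h) :=: L n :^ h.
Proof.
move=> Hh; have Nh := subsetP (normal_norm nsRH) h Hh.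
by rewrite -morphpreJ //= -gsWJ -quotientJ // -QJ.
Qed.

Let A1_L n c : c \in 'N(A) -> forall l, L l :=: L n :^ c -> A1 l :=: A1 n :^ c.
Proof. by move=> NAc l eL; rewrite /= eL centJ conjIg (normP NAc). Qed.

Let R1_A1 n l c : c \in H -> A1 l :=: A1 n :^ c -> R1 l :=: R1 n :^ c.
Proof. by move=> Hc eA; rewrite /= eA centJ conjIg (conjGid Hc). Qed.

Let pQ n : n \in A^# -> p.-group (Q n).
Proof. by move/sylQ/pHall_pgroup. Qed.

Let sLQ n : n \in A^# -> L n \subset Q n.
Proof.
move=> An; apply: (@subset_trans _ _ (coset R @*^-1 (Q n / R))).
  exact: morphpreS (gsW_sub _).
by rewrite quotientGK ?nsRQ.
Qed.

Let sRL n : R \subset L n.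
Proof. exact: sub_cosetpre. Qed.

Let A1n n : n \in A^# -> n \in A1 n.
Proof.
move=> An; have [_ An'] := setD1P An; rewrite inE An' /=.
by rewrite -sub_cent1 (subset_trans (sLQ An)) ?subsetIr.
Qed.

Let fusion n l (D : {group gT}) :
    n \in A^# -> l \in A^# -> D \subset Q n -> D \subset Q l ->
  exists c, [/\ c \in H, L l :=: L n :^ c & forall d, d \in D -> [~ d, c] \in R].
Proof.
move=> An Al sDn sDl; have [_ nRH] := andP nsRH.
have pR : p.-group R := pgroupS (sRQ An) (pQ An).
have uHR : uniq_inv (H / R) by apply: uniq_inv_quotient => //; apply: odd_pgroup_odd p_odd pR.
have sylQR k : k \in A^# -> p.-Sylow(H / R) (Q k / R).
  by move=> Ak; apply: quotient_pHall (sylQ Ak); rewrite subIset ?nRH.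
have [c CcR ec] := gsW_fusionP p_pr p_odd uHR (sylQR n An) (sylQR l Al)
  (quotientS R sDn) (quotientS R sDl).
have [b Nb Hb eb] := morphimP (subsetP (subsetIl _ _) _ CcR).
exists b; split=> // [|d Dd]; first by rewrite /= -morphpreJ // ec eb.
have Nd : d \in 'N(R).
  by apply: (subsetP nRH); apply: subsetP (subsetIl _ _) d (subsetP sDn d Dd).
apply: coset_idr; first by rewrite groupR.
rewrite morphR //=; apply/eqP/commgP/esym.
move: CcR; rewrite eb => /setIP[_ /centP]; apply.
exact: mem_quotient.
Qed.

Let norm_of_comm (D : {group gT}) c :
  R \subset D -> (forall d, d \in D -> [~ d, c] \in R) -> D :^ c = D.
Proof.
move=> sRD sDc; apply/normP; rewrite inE; apply/subsetP=> _ /imsetP[d Dd ->].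
by rewrite conjg_mulR groupM // (subsetP sRD) // sDc.
Qed.

(** [L n] fixes [l], so it lies in both stabilizers, and the fusing element [c] normalizes it
    because [[L n, c]] lies in [R], a subgroup of [L n]. Hence [L l = L n], and the sets [(A1 n)^#]
    partition [A^#]. *)
Let A1_eq n l : n \in A^# -> l \in A1 n -> l != 1 -> A1 l :=: A1 n.
Proof.
move=> An A1l ntl; have [Al Ll] := setIP A1l.
have {}Al : l \in A^# by rewrite !inE ntl.
have sLl : L n \subset Q l.
  by rewrite subsetI (subset_trans (sLQ An)) ?subsetIl //= sub_cent1.
have [c [Hc eL cL]] := fusion An Al (sLQ An) sLl.
by rewrite (norm_of_comm (sRL n) cL) in eL; rewrite /= eL.
Qed.

Let sA1A n : A1 n \subset A. Proof. exact: subsetIl. Qed.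

Let sR1Q n : n \in A^# -> R1 n \subset Q n.
Proof.
move=> An; have : 'C(A1 n) \subset 'C[n] by rewrite -cent_set1 centS // sub1set A1n.
exact: setIS.
Qed.

Let sRR1 n : R \subset R1 n.
Proof. by apply: setIS; rewrite centS. Qed.

Let sA1sharp n l : l \in (A1 n)^# -> l \in A^#.
Proof. by case/setD1P=> nt /(subsetP (sA1A n)); rewrite !inE nt. Qed.

Let blk n l h : n \in A^# -> l \in (A1 n)^# -> h \in H -> l ^ h \in (A1 n)^# ->
  h \in 'N(A1 n).
Proof.
move=> An A1l Hh A1lh; have [nt1 A1l'] := setD1P A1l; have [nt2 A1lh'] := setD1P A1lh.
have e1 := A1_eq An A1l' nt1; have e2 := A1_eq An A1lh' nt2.
by apply/normP; rewrite -[RHS]e2 (A1_L (subsetP nAH h Hh) (LJ l Hh)) e1.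
Qed.

Let QN n l : n \in A^# -> l \in (A1 n)^# -> 'C_('N_H(A1 n))[l] = Q l.
Proof.
move=> An A1l; apply/eqP; rewrite eqEsubset setSI ?subsetIl // subsetI subsetIr andbT.
apply/subsetP=> h /setIP[Hh /cent1P clh]; rewrite inE Hh (blk An A1l) //.
by rewrite (conjg_fixP _) //; apply/commgP.
Qed.

Let A1_trans n : n \in A^# -> sylow_transitive p 'N_H(A1 n) (A1 n).
Proof.
move=> An; split; rewrite ?subsetIr ?(pgroupS (sA1A n)) ?(abelianS (sA1A n)) //.
  move=> l A1l; rewrite QN //.
  apply: pHall_subl (subsetIl _ _) (sylQ (sA1sharp A1l)).
  by rewrite -(QN An A1l) subsetIl.
move=> l k A1l A1k; have [h Hh ek] := trA (sA1sharp A1l) (sA1sharp A1k).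
by exists h; rewrite // inE Hh (blk An A1l) // -ek.
Qed.

Let ltA1 n : n \in A^# -> Q n :!=: R -> #|A1 n| < #|A|.
Proof.
move=> An neQR; rewrite proper_card // properEneq sA1A andbT.
apply: contraNneq neQR => eA1; have nRQ := normal_norm (nsRQ An).
have sLR : L n \subset R.
  rewrite subsetI (subset_trans (sLQ An)) ?subsetIl //= centsC -{1}eA1.
  exact: subsetIr.
have W1 : gsW (Q n / R) = 1.
  by rewrite -(cosetpreK (gsW _)) -[coset R @*^-1 _]/(gval (L n)) (quotientS1 sLR).
have ntW := gsW_neq1 (quotient_pgroup R (pQ An)).
have [QR1 | /ntW/eqP//] := eqVneq (Q n / R) 1.
by rewrite eqEsubset (sRQ An) andbT -(quotient_sub1 nRQ) QR1.
Qed.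

(* Follows from the induction hypothesis, as [A1 n] is a block for [H] on [A^#]. *)
Let cd_cap_R1 n (X : {group gT}) : n \in A^# -> Q n :!=: R -> X \subset Q n ->
  m X <= m (X :&: R1 n).
Proof.
move=> An neQR sXQ; have sXH := subset_trans sXQ (subsetIl _ _).
have A1n' : n \in (A1 n)^# by apply/setD1P; split; [case/setD1P: An | apply: A1n].
have sXN : X \subset 'C_('N_H(A1 n))[n] by rewrite QN.
have := IHA (ltA1 An neQR) (uniq_invS (subsetIl _ _) uH) (A1_trans An) A1n' sXN.
rewrite /m /cd_measure => leX.
(* ['C_A(X)] and [A1 n] both centralize [X :&: R1 n] and meet in ['C_(A1 n)(X)]. With the bound on
   the block, the claim follows on cancelling [#|A1 n|]. *)
have leC : #|'C_A(X)| * #|A1 n| <= #|'C_A(X :&: R1 n)| * #|'C_(A1 n)(X)|.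
  have eI : 'C_A(X) :&: A1 n = 'C_(A1 n)(X).
    by rewrite setIC setIA (setIidPl (sA1A n)).
  rewrite mul_cardG eI leq_mul2r; apply/orP; right; apply: subset_leq_card.
  apply/subsetP=> _ /mulsgP[a b /setIP[Aa Xa] A1b ->].
  have Ab := subsetP (sA1A n) b A1b.
  apply/setIP; split; apply: groupM => //; first exact: subsetP (centS (subsetIl _ _)) a Xa.
  apply: subsetP A1b; rewrite centsC (subset_trans (subsetIr _ _)) // subsetIr //.
have gt0 := cardG_gt0 (A1 n); rewrite -(leq_pmul2r gt0) -mulnA.
apply: leq_trans (leq_mul (leqnn _) leC) _.
rewrite mulnCA -mulnA [leqRHS]mulnCA leq_mul2l; apply/orP; right.
apply: leq_trans leX _; rewrite leq_mul // subset_leq_card //.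
by rewrite subsetI subsetIl subsetI subIset ?sXH //= subsetIr.
Qed.

Let fam n (Y : {group gT}) := (R \subset Y) && (Y \subset R1 n).

Let star n mu (Y : {group gT}) :=
  [/\ fam n Y, m Y = mu & forall Z : {group gT}, fam n Z -> m Z = mu -> Y \subset Z].

Let famJ n l h (Y : {group gT}) :
  h \in H -> A1 l :=: A1 n :^ h -> fam l (Y :^ h)%G = fam n Y.
Proof.
move=> Hh eA; rewrite /fam (R1_A1 Hh eA) conjSg; congr (_ && _).
by rewrite -{1}(normP (subsetP (normal_norm nsRH) h Hh)) conjSg.
Qed.

Let mJ h (Y : {group gT}) : h \in H -> m (Y :^ h) = m Y.
Proof. by move=> Hh; rewrite /m -(cd_measureJ A Y h) (normP (subsetP nAH h Hh)). Qed.

Let starJ n l h mu (Y : {group gT}) :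
  h \in H -> A1 l :=: A1 n :^ h -> star n mu Y -> star l mu (Y :^ h)%G.
Proof.
move=> Hh eA [fY mY minY]; split=> [||Z fZ mZ]; [by rewrite (famJ _ Hh eA) | exact: etrans (mJ _ Hh) mY |].
have Hh' : h^-1 \in H by rewrite groupV.
have eZ : ((Z :^ h^-1) :^ h)%G = Z by apply: group_inj; rewrite /= conjsgKV.
rewrite sub_conjg; apply: minY; last exact: etrans (mJ _ Hh') mZ.
by rewrite -(famJ _ Hh eA) eZ.
Qed.

(* By submodularity the subgroups of maximal measure have a least member [Y0].
   For [n1] outside [C_A(Y0)] with a small [Y0]-orbit, the stabilizer [E] of [n1]
   in [Y0] centralizes both [C_A(Y0)] and its conjugate by the fusing element
   [c]; these meet trivially, so [E] also has maximal measure, forcing [E = Y0]. *)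
Lemma cd_measure_le_R1 n0 (Y : {group gT}) : n0 \in A^# -> Q n0 :!=: R -> fam n0 Y ->
  m Y <= #|R| * #|A|.
Proof.
move=> An0 neQR fY0.
have fR : fam n0 R by rewrite /fam subxx sRR1.
pose Ym := [arg max_(Y > R | fam n0 Y) m Y]; pose mu := m Ym.
have [fYm maxY] : fam n0 Ym /\ forall Z, fam n0 Z -> m Z <= mu.
  by rewrite /mu /Ym; case: arg_maxnP => // Z fZ maxZ; split.
apply: leq_trans (maxY Y fY0) _; rewrite leqNgt; apply/negP=> ltmu.
have neQ n : n \in A^# -> Q n :!=: R.
  move=> An; have [h Hh ->] := trA An0 An; apply: contra neQR => /eqP e.
  apply/eqP; apply: (@conjsg_inj _ h); rewrite -QJ // e.
  by rewrite (normP (subsetP (normal_norm nsRH) h Hh)).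
have bound n (Z : {group gT}) : n \in A^# -> fam n Z -> m Z <= mu.
  move=> An fZ; have [h Hh en] := trA An An0; rewrite -(mJ _ Hh); apply: maxY.
  rewrite (famJ (n := n)) //; apply: (A1_L (subsetP nAH h Hh)).
  by rewrite en LJ.
have [Y0 sY0] : exists Y0, star n0 mu Y0.
  pose f0 Z := fam n0 Z && (m Z == mu).
  have f0Ym : f0 Ym by rewrite /f0 fYm eqxx.
  case: (arg_minnP (fun Z : {group gT} => #|Z|) f0Ym) => Z0 /andP[fZ0 /eqP mZ0] minZ0.
  exists Z0; split=> // Z fZ mZ; have [[sRZ0 sZ0R1] [sRZ sZR1]] := (andP fZ0, andP fZ).
  have fI : fam n0 (Z0 :&: Z)%G by rewrite /fam subsetI sRZ0 sRZ subIset ?sZ0R1.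
  have fY : fam n0 (Z0 <*> Z)%G by rewrite /fam join_subG sZ0R1 sZR1 (subset_trans sRZ0) ?joing_subl.
  have mu_gt0 : 0 < mu by apply: leq_ltn_trans ltmu.
  have /eqP mI : m (Z0 :&: Z) == mu.
    rewrite eqn_leq (maxY _ fI) /= -(leq_pmul2r mu_gt0) -{1}mZ0 -mZ.
    apply: leq_trans (cd_measure_submodular A Z0 Z) _.
    by rewrite leq_mul2l mZ (maxY _ fY) orbT.
  have : f0 (Z0 :&: Z)%G by rewrite /f0 fI mI eqxx.
  move/minZ0 => leZ; have /eqP <- : Z0 :&: Z == Z0 by rewrite eqEcard subsetIl.
  exact: subsetIr.
have [fY0' mY0 minY0] := sY0; have [sRY0 sY0R1] := andP fY0'.
pose As (Y : {group gT}) := 'C_A(Y).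
(* [Y1] fixes [l], and by [cd_cap_R1] its intersection with [R1 l] still has measure [mu], so
   leastness at [l] puts [Y2] inside [Y1]. By transitivity of [H] the least members at [n] and [l]
   have the same order. *)
have star_eq n l (Y1 Y2 : {group gT}) : n \in A^# -> star n mu Y1 -> star l mu Y2 ->
    l \in As Y1 -> l != 1 -> Y1 :=: Y2.
  move=> An s1 s2 /setIP[Al cl] ntl; have {}Al : l \in A^# by rewrite !inE ntl.
  have [[fY1 mY1 _] [fY2 mY2 minY2]] := (s1, s2).
  have [sRY1 sY1R1] := andP fY1.
  have sY1Q : Y1 \subset Q l.
    by rewrite subsetI (subset_trans sY1R1) ?subsetIl //= sub_cent1.
  have fI : fam l (Y1 :&: R1 l)%G by rewrite /fam subsetI sRY1 sRR1 subsetIr.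
  have mI : m (Y1 :&: R1 l) = mu.
    by apply/eqP; rewrite eqn_leq (bound l (Y1 :&: R1 l)%G Al fI) -mY1 cd_cap_R1 // neQ.
  have sY21 : Y2 \subset Y1 := subset_trans (minY2 _ fI mI) (subsetIl _ _).
  have [h Hh el] := trA An Al.
  have eA : A1 l :=: A1 n :^ h.
    by rewrite el (A1_L (subsetP nAH h Hh) (LJ n Hh)).
  have [fY1h mY1h minY1h] := starJ Hh eA s1.
  apply/esym/eqP; rewrite eqEcard sY21 -(cardJg Y1 h) subset_leq_card //.
  exact: minY1h.
have A1n' n : n \in A^# -> n \in (A1 n)^#.
  by move=> An; apply/setD1P; split; [case/setD1P: An | apply: A1n].
have sA1As n Y1 : fam n Y1 -> A1 n \subset As Y1.
  by case/andP=> _ sY1; rewrite subsetI sA1A centsC (subset_trans sY1) ?subsetIr.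
have pY0 : p.-group Y0 := pgroupS (subset_trans sY0R1 (sR1Q An0)) (pQ An0).
have nAY0 : Y0 \subset 'N(A).
  by rewrite (subset_trans _ nAH) // (subset_trans sY0R1) ?subsetIl.
have prAs : 'C_A(Y0) \proper A.
  rewrite properEneq subsetIl andbT; apply: contraTneq ltmu => eA.
  have sY0R : Y0 \subset R.
    rewrite subsetI (subset_trans sY0R1) ?subsetIl //= centsC -{1}eA; exact: subsetIr.
  rewrite -leqNgt -mY0 leq_mul ?subset_leq_card // subsetIl //.
have [n1 ADn1 leE] : exists2 n1, n1 \in A :\: 'C_A(Y0) & #|Y0 : 'C_Y0[n1]| <= #|'C_A(Y0)|.
  apply: (small_orbit_outside p_pr pA pY0 prAs nAY0).
  by rewrite normsI // norms_cent ?normG.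
have [An1' nAs1] := setDP ADn1.
have An1 : n1 \in A^#.
  by rewrite !inE An1' andbT; apply: contraNneq nAs1 => ->; rewrite group1.
pose E := 'C_Y0[n1]%G.
have sRE : R \subset E.
  by rewrite subsetI sRY0 (subset_trans (sRQ An1)) ?subsetIr.
have sEQ0 : E \subset Q n0.
  by rewrite subIset // (subset_trans sY0R1 (sR1Q An0)).
have sEQ1 : E \subset Q n1.
  by rewrite setSI // (subset_trans sY0R1) ?subsetIl.
have [c [Hc eL cE]] := fusion An0 An1 sEQ0 sEQ1.
have EJ : E :^ c = E := norm_of_comm sRE cE.
have eA : A1 n1 :=: A1 n0 :^ c := A1_L (subsetP nAH c Hc) eL.
have sY1 := starJ Hc eA sY0.
(* For a nontrivial common element [l], both [Y0] and [Y0 :^ c] would equal the least member at [l];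
   then [n1], which [Y0 :^ c] centralizes, would lie in ['C_A(Y0)]. *)
have tiAs : As Y0 :&: As (Y0 :^ c)%G = 1.
  apply/trivgP/subsetP=> l /setIP[Al0 Al1]; rewrite inE; apply/eqP.
  have [// | ntl] := eqVneq l 1.
  have /setIP[Al _] := Al0; have {}Al : l \in A^# by rewrite !inE ntl.
  have [h Hh el] := trA An0 Al.
  have eAl : A1 l :=: A1 n0 :^ h by rewrite el (A1_L (subsetP nAH h Hh) (LJ n0 Hh)).
  have sl := starJ Hh eAl sY0.
  have e0 := star_eq n0 l Y0 _ An0 sY0 sl Al0 ntl.
  have e1 := star_eq n1 l (Y0 :^ c)%G _ An1 sY1 sl Al1 ntl.
  case/negP: nAs1; rewrite e0 -e1.
  have [fY1 _ _] := sY1.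
  by have := subsetP (sA1As n1 _ fY1) n1 (A1n An1).
have sEAs : As Y0 * As (Y0 :^ c)%G \subset 'C_A(E).
  rewrite mul_subG // setIS // centS ?subsetIl //.
  by rewrite -EJ conjSg subsetIl.
have fE : fam n0 E by rewrite /fam sRE subIset ?sY0R1.
(* The choice of [n1] bounds [|Y0 : E|] by [|C_A(Y0)|], and the two trivially meeting conjugates of
   ['C_A(Y0)] show that [|C_A(Y0)|^2] is at most [|C_A(E)|]. *)
have mE : m E = mu.
  apply/eqP; rewrite eqn_leq (maxY _ fE) /= -mY0 /m /cd_measure.
  rewrite -(Lagrange (subsetIl Y0 'C[n1])) -mulnA leq_mul2l; apply/orP; right.
  apply: leq_trans (subset_leq_card sEAs); rewrite TI_cardMg // leq_mul //.
  by rewrite -(cardJg 'C_A(Y0) c) conjIg -centJ (normP (subsetP nAH c Hc)).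
have := minY0 _ fE mE; rewrite subsetI subxx /= sub_cent1 => cn1.
by case/negP: nAs1; rewrite inE An1'.
Qed.

Lemma cd_measure_le_step n (X : {group gT}) : n \in A^# -> X \subset Q n ->
  m X <= #|'C_X(A)| * #|A|.
Proof.
move=> An sXQ; have sXH := subset_trans sXQ (subsetIl _ _).
have eXR : 'C_X(A) = X :&: R by rewrite [RHS]setIA (setIidPl sXH).
have [eQR | neQR] := eqVneq (Q n : {set gT}) R.
  rewrite eXR (setIidPl _) -?eQR // leq_mul // subset_leq_card //.
  exact: subsetIl.
have nRX : X \subset 'N(R) := subset_trans sXH (normal_norm nsRH).
have sXRQ : X <*> R \subset Q n by rewrite join_subG sXQ sRQ.
have leXR : m (X <*> R) <= #|R| * #|A|.
  apply: leq_trans (cd_cap_R1 An neQR sXRQ) _.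
  apply: (cd_measure_le_R1 (Y := (X <*> R :&: R1 n)%G) An neQR).
  by rewrite /fam subsetI joing_subr sRR1 subsetIr.
have eC : 'C_A(X <*> R) = 'C_A(X).
  rewrite centY setIA; apply/setIidPl.
  by rewrite subIset // centsC subsetIr.
(* [X <*> R] has the same centralizer in [A] as [X], and its order is [|X| |R| / |X :&: R|]. *)
rewrite eXR -(leq_pmul2l (cardG_gt0 R)) [leqRHS]mulnCA.
have le1 : (#|X :&: R| * m (X <*> R) <= #|X :&: R| * (#|R| * #|A|))%N.
  by rewrite leq_pmul2l ?cardG_gt0.
apply: leq_trans le1; rewrite /m /cd_measure eC norm_joinEl //.
by rewrite [leqRHS]mulnA [(#|X :&: R| * _)%N]mulnC -mul_cardG mulnA [(#|R| * _)%N]mulnC.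
Qed.

End Offender.

Theorem sylow_transitive_cd_measure (p : nat) (gT : finGroupType) (H A : {group gT}) :
    prime p -> odd p -> uniq_inv H -> sylow_transitive p H A ->
  {in A^#, forall n (X : {group gT}), X \subset 'C_H[n] ->
    cd_measure A X <= #|'C_X(A)| * #|A|}.
Proof.
move=> p_pr p_odd; have [k] := ubnP #|A|; elim: k => // k IHk in H A *.
move=> leAk uH trHA n An X sXQ.
apply: (cd_measure_le_step p_pr p_odd uH trHA) An sXQ => H1 A1 ltA1 uH1 trHA1.
by apply: IHk => //; apply: leq_trans ltA1 _.
Qed.

(** * Isaacs groups *)

Lemma irr1_le_index_constt (gT : finGroupType) (G H : {group gT}) (i : Iirr G) (j : Iirr H) :
    H \subset G -> j \in irr_constt ('Res[H] 'chi_i)%R ->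
  ('chi_i 1%g <= #|G : H|%:R * 'chi_j 1%g)%R.
Proof.
move=> sHG; rewrite -constt_Ind_Res => constt_i; rewrite -cfInd1 //.
by apply: char1_ge_constt; rewrite ?cfInd_char ?irr_char.
Qed.

Lemma irr1_abelian_index (gT : finGroupType) (G H : {group gT}) (i : Iirr G) :
  H \subset G -> abelian H -> ('chi_i 1%g <= #|G : H|%:R :> algC)%R.
Proof.
move=> sHG abH; have [j constt_j] := neq0_has_constt (Res_irr_neq0 H i).
have := irr1_le_index_constt sHG constt_j.
by rewrite (lin_char1 (char_abelianP _ abH j)) mulr1.
Qed.

(** The square of the degree is at most the index of the center of the character. Unless the kernel
    is all of [P], this center properly contains the kernel, since [P] is nilpotent, so the bound
    [q ^ 2] becomes strict. *)
Lemma pgroup_irr1_lt (p : nat) (gT : finGroupType) (P N : {group gT}) (i : Iirr P) (q : nat) :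
    p.-group P -> N \subset P -> #|P : N| = (q ^ 2)%N -> 1 < q -> N \subset cfker ('chi_i)%R ->
  ('chi_i 1%g < q%:R :> algC)%R.
Proof.
move=> pP sNP iPN q_gt1 sNK; set K := cfker ('chi_i)%R in sNK *.
have nsKP : K <| P := cfker_normal _; have [sKP nKP] := andP nsKP.
have [eKP | neKP] := eqVneq K P.
  have /lin_char1 -> : ('chi_i)%R \is a linear_char by rewrite lin_irr_der1 -/K eKP der_sub.
  by rewrite ltr1n.
rewrite -(@ltr_pXn2r _ 2) ?nnegrE ?char1_ge0 ?irr_char ?ler0n //.
have [le_bound _] := irr1_bound i; apply: le_lt_trans le_bound _.
rewrite -natrX ltr_nat -iPN.
have [sKZ nKZ] := andP (cfker_center_normal ('chi_i)%R); rewrite -/K in sKZ nKZ.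
have prKZ : K \proper 'Z(('chi_i)%R)%CF.
  rewrite properE sKZ -quotient_sub1 // cfcenter_eq_center subG1.
  rewrite center_nil_eq1 ?quotient_nil ?(pgroup_nil pP) //.
  rewrite -subG1 quotient_sub1 //; apply: contra neKP => sPK.
  by rewrite eqEsubset sKP.
have prNZ : N \proper 'Z(('chi_i)%R)%CF := sub_proper_trans sNK prKZ.
rewrite -(@ltn_pmul2l #|N|) ?cardG_gt0 // (Lagrange sNP) -(Lagrange (cfcenter_sub ('chi_i)%R)).
by rewrite ltn_pmul2r ?proper_card.
Qed.

(** The sum of ['chi_j] over [N] is [#|N|] times the multiplicity of the principal character in its
    restriction; for normal [N] this is nonzero only if [N] lies in the kernel. *)
Lemma Res_principal_eq0 (gT : finGroupType) (P N : {group gT}) (phi : 'CF(P)) :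
    N <| P -> {in irr_constt phi, forall j, ~~ (N \subset cfker ('chi_j)%R)} ->
  (\sum_(x in N) phi x = 0)%R.
Proof.
move=> nsNP ker_j; have sNP := normal_sub nsNP.
rewrite (cfun_sum_constt phi).
under eq_bigr do rewrite sum_cfunE.
rewrite exchange_big big1 //= => j constt_j.
under eq_bigr do rewrite cfunE.
rewrite -mulr_sumr; apply/eqP; rewrite mulf_eq0; apply/orP; right.
have : '['Res[N] 'chi_j, 'chi_0]%R == 0%R.
  by apply: contraR (ker_j j constt_j); apply: constt0_Res_cfker.
rewrite cfdotE mulf_eq0 invr_eq0 (negPf (neq0CG N)) /= => /eqP e0.
apply/eqP; rewrite -[RHS]e0; apply: eq_bigr => x Nx.
by rewrite irr0 cfun1E Nx conjC1 mulr1 cfResE.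
Qed.

Section IsaacsGroup.

Variables (p a : nat) (gT : finGroupType) (G : {group gT}) (i : Iirr G).
Hypotheses (p_pr : prime p) (a_gt0 : 0 < a).
Let q := (p ^ a)%N.
Let chi := ('chi_i)%R.
Hypothesis oG : #|G| = (q ^ 4 - q ^ 3)%N.
Hypothesis chi1 : chi 1%g = (q ^ 2 - q)%N%:R%R.

Let q_gt1 : 1 < q.
Proof. by rewrite (leq_trans (prime_gt1 p_pr)) // -{1}(expn1 p) leq_exp2l ?prime_gt1. Qed.

Let oG' : #|G| = (q ^ 3 * q.-1)%N.
Proof. by rewrite oG -subn1 mulnBr muln1 -expnSr. Qed.

Let chi1' : chi 1%g = (q%:R * (q%:R - 1))%R.
Proof.
rewrite chi1 natrB ?natrX; first by rewrite expr2; ring.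
by rewrite -{1}(expn1 q) leq_exp2l.
Qed.

Lemma isaacs_card_Sylow (P : {group gT}) : p.-Sylow(G) P -> #|P| = (q ^ 3)%N.
Proof.
move/card_Hall->; rewrite oG' partnM ?expn_gt0 ?(prime_gt0 p_pr) // -?subn1 ?subn_gt0 //.
rewrite part_pnat_id ?pnatX ?pnat_id // (part_p'nat _) ?muln1 //.
rewrite p'natE //; apply/negP=> dv_p; have := dvdn_sub (dvdn_exp a_gt0 (dvdnn p)) dv_p.
have -> : (p ^ a - (q - 1) = 1)%N by rewrite -/q; rewrite subKn // ltnW.
by rewrite dvdn1 => /eqP p1; move: p_pr; rewrite p1.
Qed.

Let normsum : (\sum_(x in G) chi x * (chi x)^* = #|G|%:R)%R.
Proof.
by have := cfnorm_irr i; rewrite cfdotE => e; rewrite -[LHS](mulVKf (neq0CG G)) e mulr1.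
Qed.

Let q_neq0 : (q%:R != 0 :> algC)%R.
Proof. by rewrite pnatr_eq0 -lt0n ltnW. Qed.

Let natr_q1 : (q.-1%:R = q%:R - 1 :> algC)%R.
Proof. by rewrite -subn1 natrB // ltnW. Qed.

Let conj_q : (q%:R^* = q%:R :> algC)%R.
Proof. exact: conjC_nat. Qed.

(* The constituents of [chi] on a Sylow subgroup have degree at least [q], so
   [chi] sums to 0 over [N]; with ['[chi] = 1] this makes the sum of
   [|chi + q|^2] over [N^#] and of [|chi|^2] outside [N] vanish. *)
Lemma isaacs_irr_values : exists N : {group gT},
  [/\ N \subset G, p.-group N, #|N| = q, {in N^#, forall x, chi x = - q%:R}%R
    & {in G :\: N, forall x, chi x = 0%R}].
Proof.
have [P sylP] := Sylow_exists p G; have [sPG pP _] := and3P sylP; have oP := isaacs_card_Sylow sylP.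
have iGP : #|G : P| = q.-1 by rewrite -divgS // oG' oP mulKn // expn_gt0 ltnW.
have le_a : a <= logn p #|P| by rewrite oP -expnM pfactorK // leq_pmulr.
have [N [_ nsNP oN]] := normal_pgroup pP (normal_refl P) le_a; rewrite -/q in oN.
have [sNP nNP] := andP nsNP; have sNG := subset_trans sNP sPG.
have sum0 : (\sum_(x in N) chi x = 0)%R.
  have := @Res_principal_eq0 _ P N ('Res[P] chi)%R nsNP.
  under eq_bigr => x Nx do rewrite cfResE ?(subsetP sNP) //.
  apply=> j constt_j; apply/negP=> sNK.
  have iPN : #|P : N| = (q ^ 2)%N by rewrite -divgS // oP oN expnS mulKn // ltnW.
  have lt_j := pgroup_irr1_lt pP sNP iPN q_gt1 sNK.
  have le_j := irr1_le_index_constt sPG constt_j; rewrite -/chi chi1' iGP in le_j.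
  rewrite natr_q1 in le_j.
  have q1_gt0 : (0 < q%:R - 1 :> algC)%R by rewrite subr_gt0 ltr1n.
  rewrite -(ltr_pM2l q1_gt0) in lt_j.
  by have := le_lt_trans le_j lt_j; rewrite mulrC ltxx.
have nu_ge0 (u : algC) : (0 <= u * u^*)%R by apply: mul_conjC_ge0.
have N1 : 1%g \in N := group1 N.
have oN1 : #|N^#| = q.-1 by rewrite (cardsD1 1%g N) N1 /= in oN; rewrite -oN.
have sum1 : (\sum_(x in N^#) chi x = - chi 1%g)%R.
  by apply: (addrI (chi 1%g)); rewrite subrr -[RHS]sum0 [RHS](big_setD1 1%g).
have sum1C : (\sum_(x in N^#) (chi x)^* = - chi 1%g)%R.
  by rewrite -rmorph_sum sum1 rmorphN /= chi1 conjC_nat.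
(* As [chi 1 = q (q - 1)], the value [- q] is the average of [chi] on [N^#]. The norm leaves exactly
   [q^2 (q - 1)] for the elements other than 1, which is what cancels here. *)
have eT : (\sum_(x in N^#) (chi x + q%:R) * (chi x + q%:R)^* = 
    \sum_(x in N^#) chi x * (chi x)^* - q%:R ^+ 2 * (q%:R - 1))%R.
  rewrite (eq_bigr (fun x => chi x * (chi x)^* + q%:R * chi x + q%:R * (chi x)^* + q%:R ^+ 2)%R); last first.
    by move=> x _; rewrite rmorphD /= conj_q; ring.
  rewrite !big_split /= -!mulr_sumr sum1 sum1C sumr_const oN1 -[(_ *+ q.-1)%R]mulr_natr natr_q1.
  by rewrite chi1'; ring.
have eS : (\sum_(x in N^#) chi x * (chi x)^* + \sum_(x in G :\: N) chi x * (chi x)^*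
    = q%:R ^+ 2 * (q%:R - 1))%R.
  have := normsum; rewrite (big_setID N) /= (setIidPr sNG) (big_setD1 1%g) //= => e.
  have e1 : (chi 1%g)^*%R = chi 1%g by rewrite chi1 conjC_nat.
  rewrite e1 oG' natrM natrX natr_q1 chi1' in e.
  apply: (addrI (q%:R * (q%:R - 1) * (q%:R * (q%:R - 1)))%R); rewrite addrA e.
  by ring.
have /eqP := eT; rewrite -eS opprD addrA subrr sub0r -addr_eq0 => /eqP eTS.
have T_ge0 : (0 <= \sum_(x in N^#) (chi x + q%:R) * (chi x + q%:R)^*)%R by apply: sumr_ge0.
have S_ge0 : (0 <= \sum_(x in G :\: N) chi x * (chi x)^*)%R by apply: sumr_ge0.
move/eqP: eTS; rewrite paddr_eq0 // => /andP[/eqP T0 /eqP S0].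
exists N; split=> //; first exact: pgroupS sNP pP.
  move=> x Nx; move/eqP: T0; rewrite psumr_eq0 // => /allP/(_ x (mem_index_enum _)).
  by rewrite Nx mul_conjC_eq0 addr_eq0 => /eqP.
move=> x Nx; move/eqP: S0; rewrite psumr_eq0 // => /allP/(_ x (mem_index_enum _)).
by rewrite Nx mul_conjC_eq0 => /eqP.
Qed.

Lemma isaacs_kernel : exists N : {group gT},
  [/\ N <| G, p.-group N /\ abelian N, #|N| = q,
      {in N^#, forall x, p.-Sylow(G) 'C_G[x]}
    & {in N^# &, forall x y, exists2 g, g \in G & y = x ^ g}].
Proof.
have [N [sNG pN oN chiN chi0]] := isaacs_irr_values.
have nNG : G \subset 'N(N).
  apply/subsetP=> g Gg; rewrite inE; apply/subsetP=> _ /imsetP[x Nx ->].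
  have [-> | ntx] := eqVneq x 1%g; first by rewrite conj1g.
  apply: contraT => notN; have Gx := subsetP sNG x Nx.
  have /chi0/eqP : x ^ g \in G :\: N by rewrite inE notN groupJ.
  rewrite /chi cfunJ // -/chi chiN ?oppr_eq0 ?(negPf q_neq0) //.
  by rewrite !inE ntx.
have nsNG : N <| G by apply/andP.
(* If ['chi_j] summed to 0 over [N], its inner product with [chi] would be [q^2 'chi_j(1) / |G|],
   against orthogonality. *)
have ker_j j : j != i -> N \subset cfker ('chi_j)%R.
  move=> neqji; apply: contraT => not_sNK.
  have sum0 : (\sum_(x in N) 'chi_j x = 0)%R.
    by apply: Res_principal_eq0 => // k; rewrite constt_irr => /eqP ->.
  have := cfdot_irr j i; rewrite (negPf neqji) cfdotE => /eqP.
  rewrite mulf_eq0 invr_eq0 (negPf (neq0CG G)) /= (big_setID N) /= (setIidPr sNG).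
  rewrite [X in (_ + X)%R]big1 ?addr0 => [|x /chi0]; last by rewrite /chi => ->; rewrite conjC0 mulr0.
  rewrite (big_setD1 1%g) //= -/chi chi1 conjC_nat.
  rewrite (eq_bigr (fun x => 'chi_j x * - q%:R))%R => [|x Nx]; last by rewrite chiN // rmorphN /= conj_q.
  have e1 : (\sum_(x in N^#) 'chi_j x = - 'chi_j 1%g)%R.
    by apply: (addrI ('chi_j 1%g)%R); rewrite subrr -[RHS]sum0 [RHS](big_setD1 1%g).
  rewrite -mulr_suml e1 mulrNN -mulrDr mulf_eq0 (negPf (irr1_neq0 j)) /= -natrD subnK.
    by rewrite pnatr_eq0 expn_eq0 eqn0Ngt (ltnW q_gt1).
  by rewrite -{1}(expn1 q) leq_exp2l.
(* [chi] contributes [q^2], and the other characters, constant on [N], contribute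
   [|G| - chi(1)^2 = q^3 - q^2]. By the second orthogonality relation this nonzero value yields both
   the conjugacy and the order of the centralizers. *)
have sum_q3 : {in N^# &, forall x y, (\sum_j 'chi[G]_j x * ('chi_j y)^* = q%:R ^+ 3)%R}.
  move=> x y Nx Ny; have [[ntx Nx'] [nty Ny']] := (setD1P Nx, setD1P Ny).
  rewrite (bigD1 i) //= -/chi !chiN // rmorphN /= conj_q mulrNN.
  rewrite (eq_bigr (fun j => 'chi[G]_j 1%g ^+ 2))%R => [|j /ker_j sNK]; last first.
    rewrite !(cfker1 (subsetP sNK _ _)) // expr2.
    by rewrite (geC0_conj (char1_ge0 (irr_char j))).
  have := irr_sum_square G; rewrite (bigD1 i) //= -/chi => /(canRL (addKr _)) ->.
  by rewrite oG' natrM natrX natr_q1 chi1'; ring.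
have q3_neq0 : (q%:R ^+ 3 != 0 :> algC)%R by rewrite expf_neq0.
have sec x y : x \in N^# -> y \in N^# ->
    (q%:R ^+ 3 = #|'C_G[x]|%:R *+ (x \in y ^: G) :> algC)%R.
  move=> Nx Ny; rewrite -(sum_q3 x y Nx Ny) second_orthogonality_relation //.
  by rewrite (subsetP sNG) //; case/setD1P: Ny.
have conjN : {in N^# &, forall x y, exists2 g, g \in G & y = x ^ g}.
  move=> x y Nx Ny; have := sec y x Ny Nx.
  have [/imsetP[g Gg ->] _ | _ e] := boolP (y \in x ^: G); first by exists g.
  by move: q3_neq0; rewrite e mulr0n eqxx.
have sylC : {in N^#, forall x, p.-Sylow(G) 'C_G[x]}.
  move=> x Nx; have := sec x x Nx Nx; rewrite class_refl mulr1n -natrX => /eqP.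
  rewrite eqr_nat => /eqP oC; have [P sylP] := Sylow_exists p G.
  by rewrite pHallE subsetIl -oC -(isaacs_card_Sylow sylP) (card_Hall sylP) /=.
have ntN : N :!=: 1%g by rewrite trivg_card1 oN neq_ltn q_gt1 orbT.
exists N; split=> //; split=> //.
have := ntN; rewrite -(center_nil_eq1 (pgroup_nil pN)) => /trivgPn[z Zz ntz].
have Nz : z \in N^# by rewrite !inE ntz; case/setIP: Zz.
have nsZG : 'Z(N) <| G := gFnormal_trans _ nsNG.
apply: (@subset_trans _ _ 'Z(N)); last exact: subsetIr.
apply/subsetP=> x Nx; have [-> | ntx] := eqVneq x 1%g; first exact: group1.
have [|g Gg ->] := conjN z x Nz; first by rewrite !inE ntx.
by rewrite memJ_norm // (subsetP (normal_norm nsZG)).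
Qed.

End IsaacsGroup.

(** [n * n ^ t] is fixed by [t], hence trivial. *)
Lemma involution_inverts (gT : finGroupType) (A : {group gT}) (t : gT) :
    abelian A -> t \in 'N(A) -> t ^+ 2 = 1 -> 'C_A[t] = 1 ->
  {in A, forall n, n ^ t = n^-1}.
Proof.
move=> abA Nt t2 CAt n An; have Ant : n ^ t \in A by rewrite memJ_norm.
apply/eqP; rewrite eq_sym eq_invg_mul -in_set1 -[[set 1]]CAt inE groupM //=.
apply/cent1P/commgP/conjg_fixP; rewrite conjMg -conjgM -expg2 t2 conjg1.
by rewrite (centsP abA).
Qed.

(* [k |-> [~ k, t]] is injective, so every element is a commutator, which [t] inverts. *)
Lemma regular_involution_abelian (gT : finGroupType) (K : {group gT}) (t : gT) :
  t \in 'N(K) -> t ^+ 2 = 1 -> 'C_K[t] = 1 -> abelian K.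
Proof.
move=> Nt t2 CKt; pose f k := [~ k, t].
have fK k : k \in K -> f k \in K.
  by move=> Kk; rewrite /f commgEl groupM ?groupV ?memJ_norm.
have inj_f : {in K &, injective f}.
  move=> k l Kk Kl; rewrite /f !commgEl => e; apply/eqP; rewrite eq_mulgV1 -in_set1 -[[set 1]]CKt.
  rewrite inE groupM ?groupV //=; apply/cent1P/commgP/conjg_fixP.
  rewrite conjMg conjVg; have -> : k ^ t = k * (l^-1 * l ^ t) by rewrite -e mulKVg.
  by rewrite mulgA mulgK.
have fKK : f @: K = K.
  apply/eqP; rewrite eqEcard card_in_imset // leqnn andbT.
  by apply/subsetP=> _ /imsetP[l Kl ->]; apply: fK.
have inv k : k \in K -> k ^ t = k^-1.
  rewrite -{1}fKK.
  case/imsetP=> l Kl ->; rewrite /f commgEl conjMg -conjgM -expg2 t2 conjg1.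
  by rewrite invMg invgK conjVg.
apply/centsP=> k Kk l Kl; apply: invg_inj.
by rewrite -(inv _ (groupM Kk Kl)) conjMg !inv // invMg.
Qed.

Theorem theorem3 (p a : nat) (gT : finGroupType) (G S Z K : {group gT})
    (p_prime : prime p) (p_odd : odd p) (a_ge1 : (1 <= a)%N)
    (isaacsG : isaacs_group (p ^ a)%N G)
    (sylS : 2.-Sylow(G) S)
    (uniqZ : unique_subgroup_of_order 2 Z S)
    (defK : K :=: 'O_p(G)) :
  [/\ G :=: K * 'N_G(Z),
      'N_G(Z) :&: K = 'C_K(Z)
    & 'C_K(Z) :!=: 1].
Proof.
have [q_gt1 oG [i chi1]] := isaacsG; pose q := (p ^ a)%N.
have [N [nsNG [pN abN] oN sylC conjN]] := isaacs_kernel p_prime a_ge1 oG chi1.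
have [sNG nNG] := andP nsNG.
have [sZS oZ _] := uniqZ; have sZG : Z \subset G := subset_trans sZS (pHall_sub sylS).
have [z ot defZ] : exists2 z, #[z] = 2 & Z :=: <[z]>.
  have /cyclicP[z dZ] : cyclic Z by rewrite prime_cyclic ?oZ.
  by exists z; rewrite // orderE -dZ.
have Zz : z \in Z by rewrite defZ cycle_id.
have Gz := subsetP sZG z Zz.
have [n Nn] : exists n, n \in N^#.
  have /trivgPn[n Nn ntn] : N :!=: 1 by rewrite trivg_card1 oN neq_ltn q_gt1 orbT.
  by exists n; rewrite !inE ntn.
have [P sylP] := Sylow_exists p G; have [sPG pP _] := and3P sylP.
have pK : p.-group K by rewrite defK pcore_pgroup.
have nsKG : K <| G by rewrite defK pcore_normal.
have [sKG nKG] := andP nsKG.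
have defCN : K :=: 'C_G(N).
  apply/eqP; rewrite eqEsubset; apply/andP; split.
    rewrite subsetI sKG; apply/centsP=> k Kk m Nm.
    have [-> | ntm] := eqVneq m 1; first exact: commute1.
    have Nm' : m \in N^# by rewrite !inE ntm.
    have : k \in 'C_G[m] by apply: subsetP Kk; rewrite defK pcore_sub_Hall ?sylC.
    by case/setIP=> _ /cent1P/commute_sym.
  rewrite defK pcore_max //.
    apply: pgroupS (pHall_pgroup (sylC n Nn)).
    have : 'C(N) \subset 'C[n] by rewrite -cent_set1 centS // sub1set; case/setD1P: Nn.
    exact: setIS.
  by rewrite /normal subsetIl normsI ?normG // norms_cent.
(* Centralizers of elements of [N^#] are [p]-groups with [p] odd, so an involution fixes no such
   element. *)
have inv_N t : t \in G -> #[t] = 2 -> {in N, forall m, m ^ t = m^-1}.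
  move=> Gt o2; apply: involution_inverts => //; first exact: subsetP nNG t Gt.
    by rewrite -o2 expg_order.
  apply/trivgP/subsetP=> m /setIP[Nm cm]; rewrite inE; apply: contraT => ntm.
  have Nm' : m \in N^# by rewrite !inE ntm.
  have Ct : t \in 'C_G[m] by rewrite inE Gt cent1C.
  have := mem_p_elt (pHall_pgroup (sylC m Nm')) Ct.
  by rewrite /p_elt o2 pnatE // inE => /eqP p2; move: p_odd; rewrite -p2.
have inv_inv t u : t \in G -> u \in G -> #[t] = 2 -> #[u] = 2 -> t * u^-1 \in K.
  move=> Gt Gu o2t o2u; rewrite defCN inE groupM ?groupV //=.
  apply/centP=> m Nm; apply/commute_sym/commgP/conjg_fixP.
  by apply: (@conjg_inj _ u); rewrite conjgM conjgKV (inv_N t) // (inv_N u).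
have oddK : odd #|K| := odd_pgroup_odd p_odd pK.
have coKZ : coprime #|K| #|Z| by rewrite oZ coprimen2.
have tiKZ : K :&: Z = 1 := coprime_TIg coKZ.
have nKZ : Z \subset 'N(K) := subset_trans sZG nKG.
have eKZ : K <*> Z = K * Z by rewrite norm_joinEr.
(* All involutions invert [N], so they agree modulo ['C_G(N) = K]; thus [z ^ g] lies in [K z]. *)
have nsKZG : K <*> Z <| G.
  rewrite /normal join_subG sKG sZG; apply/subsetP=> g Gg; rewrite inE -genJ gen_subG conjUg.
  rewrite subUset (normP (subsetP nKG g Gg)) joing_subl defZ -cycleJ cycle_subG /= -defZ.
  have -> : z ^ g = (z ^ g * z^-1) * z by rewrite mulgKV.
  by rewrite eKZ mem_mulg // inv_inv ?groupJ // orderJ.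
have sylZ : 2.-Sylow(K <*> Z) Z.
  have p'K : 2^'.-nat #|K| by rewrite -odd_2'nat.
  by rewrite pHallE joing_subr /= eKZ TI_cardMg // oZ partnM // (part_p'nat p'K) mul1n part_pnat_id.
have GE : K * 'N_G(Z) = G.
  have := Frattini_arg nsKZG sylZ; rewrite /= eKZ -mulgA mulSGid //.
  by rewrite subsetI sZG normG.
have cNZ g : g \in 'N(Z) -> g \in 'C(Z).
  move=> Ng; have Zzg : z ^ g \in Z by rewrite memJ_norm.
  rewrite defZ cent_cycle; apply/cent1P/commute_sym/commgP/conjg_fixP.
  have : z ^ g \in <[z]> by rewrite -defZ.
  rewrite cycle2g // !inE conjg_eq1 -order_eq1 ot /= => /eqP //.
split; first by rewrite GE.
  apply/setP=> g; apply/setIP/setIP=> [[/setIP[_ Ng] Kg] | [Kg Cg]]; split=> //.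
    exact: cNZ.
  by rewrite inE (subsetP sKG) //= (subsetP (cent_sub Z)).
apply/eqP=> CKZ1.
have z2 : z ^+ 2 = 1 by rewrite -ot expg_order.
have abK : abelian K.
  apply: (regular_involution_abelian (t := z)) => //; first exact: subsetP nKG z Gz.
  by rewrite -cent_cycle -defZ.
pose H := 'N_G(Z)%G; have sHG : H \subset G := subsetIl _ _.
have cHZ : H \subset 'C(Z) by apply/subsetP=> g /setIP[_ /cNZ].
have tiKH : K :&: H = 1.
  by apply/trivgP; rewrite -CKZ1 setIS.
have oH : (#|K| * #|H|)%N = #|G| by rewrite -GE TI_cardMg.
(* [#|H| = #|G : K|] is at least the degree [q (q - 1)], and [#|G|] is [q ^ 2] times that degree. *)
have le_K : #|K| <= q ^ 2.
  have := irr1_abelian_index i sKG abK; rewrite chi1 Num.Theory.ler_nat -divgS // -oH mulKn ?cardG_gt0 //.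
  have q_gt0 : 0 < q by rewrite ltnW.
  have q1_gt0 : 0 < q - 1 by rewrite subn_gt0.
  rewrite -/q => leH; rewrite -(@leq_pmul2r (q * (q - 1))) ?muln_gt0 ?q_gt0 //.
  apply: (@leq_trans (#|K| * #|H|)); first by rewrite leq_mul2l mulnBr muln1 mulnn leH orbT.
  by rewrite oH oG -/q !mulnBr muln1 !expnS expn0 !muln1 !mulnA.
have uH : uniq_inv H.
  move=> t u Ht Hu ot' ou'; have Kv : t * u^-1 \in K by rewrite inv_inv ?(subsetP sHG).
  apply/eqP; rewrite eq_mulgV1 -in_set1 -[[set 1]]tiKH inE Kv.
  by rewrite groupM ?groupV.
have eC m : m \in N^# -> (#|K| * #|'C_H[m]|)%N = (q ^ 3)%N.
  move=> Nm; have sKm : K \subset 'C[m].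
    rewrite (subset_trans _ (_ : 'C(N) \subset _)) ?defCN ?subsetIr //.
    by rewrite -cent_set1 centS // sub1set; case/setD1P: Nm.
  have tiKC : K :&: 'C_H[m] = 1 by apply/trivgP; rewrite -tiKH setIS ?subsetIl.
  rewrite -(isaacs_card_Sylow p_prime a_ge1 oG (sylC m Nm)) -TI_cardMg //.
  by rewrite group_modl // GE.
have pPart : (#|K| * #|H|`_p)%N = (q ^ 3)%N.
  rewrite -(isaacs_card_Sylow p_prime a_ge1 oG sylP) (card_Hall sylP) -oH partnM ?cardG_gt0 //.
  by rewrite (part_pnat_id pK).
have trHN : sylow_transitive p H N.
  split=> //; first exact: subset_trans nNG.
    move=> m Nm; rewrite pHallE subsetIl /= -(@eqn_pmul2l #|K|) ?cardG_gt0 //.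
    by rewrite pPart eC.
  move=> l m Nl Nm; have [g Gg em] := conjN l m Nl Nm.
  have /mulsgP[k h Kk Hh eg] : g \in K * H by rewrite GE.
  exists h => //; rewrite em eg conjgM; congr (_ ^ _); apply/conjg_fixP/commgP.
  have : k \in 'C_G(N) by rewrite -defCN.
  by case/setIP=> _ /centP ck; apply/commute_sym/ck; case/setD1P: Nl.
(* For [X = 'C_H[n]] the right-hand side is just [#|N| = q], as ['C_H(N)] lies in [K :&: H = 1]. But
   [#|X|] is [q ^ 3] divided by [#|K|], so at least [q], and ['C_N(X)] contains [n]. *)
have := sylow_transitive_cd_measure p_prime p_odd uH trHN Nn (subxx 'C_H[n]%G).
have -> : 'C_('C_H[n])(N) = 1.
  apply/trivgP/subsetP=> h /setIP[/setIP[Hh _] Ch].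
  by rewrite -tiKH inE Hh andbT defCN inE (subsetP sHG).
rewrite /cd_measure cards1 mul1n oN -/q; apply/negP; rewrite -ltnNge.
have q_gt0 : 0 < q by rewrite ltnW.
have le_Q : q <= #|'C_H[n]|.
  rewrite -(@leq_pmul2l #|K|) ?cardG_gt0 // eC // expnSr leq_mul2r le_K orbT //.
have Cn : n \in 'C_N('C_H[n]).
  rewrite inE -sub_cent1 subsetIr andbT; by case/setD1P: Nn.
have C_gt1 : 1 < #|'C_N('C_H[n])|.
  by rewrite cardG_gt1; apply/trivgPn; exists n => //; case/setD1P: Nn.
apply: leq_ltn_trans le_Q _; rewrite -{1}[#|_|]muln1 ltn_pmul2l // cardG_gt0 //.
Qed.
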